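(* Let $\{L_n,W_n\}_{n\in\mathbb{Z}}$ be a lowest weight representation of the $\mathcal{W}_3$-algebra with central charge $c\neq-\frac{22}{5}$ on a complex vector space $V$, with cyclic lowest weight vector $\Omega$ satisfying $L_{-1}\Omega=0$. Then there is a vertex operator algebra structure on $V$ with vacuum vector $\Omega$, translation operator $L_{-1}$ and conformal (Virasoro) vector $\nu=L_{-2}\Omega$, generated by the fields $L(z)=\sum_nL_nz^{-n-2}$ and $W(z)=\sum_nW_nz^{-n-3}$. If moreover the representation is unitary (that is, $V$ carries an inner product which is invariant for the representation), then this vertex operator algebra is a simple unitary vertex operator algebra.
   Context: Let $V$ be a complex vector space. A formal series $\sum_{n\in\mathbb{Z}}A_n z^{-n}$ with $A_n\in\mathrm{End}(V)$ is a field on $V$ if for every $v\in V$ there is $n_v$ with $A_nv=0$ for all $n\ge n_v$. A representation of the $\mathcal{W}_3$-algebra with central charge $c\in\mathbb{C}$, $c\ne-\frac{22}{5}$, on $V$ consists of linear operators $\{L_n,W_n\}_{n\in\mathbb{Z}}$ on $V$ such that $L(z)=\sum_n L_nz^{-n-2}$ and $W(z)=\sum_n W_nz^{-n-3}$ are fields and, for all $m,n\in\mathbb{Z}$, $$[L_m,L_n]=(m-n)L_{m+n}+\tfrac{c}{12}m(m^2-1)\delta_{m+n,0},\qquad [L_m,W_n]=(2m-n)W_{m+n},$$ $$[W_m,W_n]=\tfrac{c}{3\cdot5!}(m^2-4)(m^2-1)m\,\delta_{m+n,0}+b^2(m-n)\Lambda_{m+n}+\tfrac{1}{30}(m-n)(2m^2-mn+2n^2-8)L_{m+n},$$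 where $b^2=\frac{16}{22+5c}$ and $\Lambda_n=\sum_{k>-2}L_{n-k}L_k+\sum_{k\le-2}L_kL_{n-k}-\frac{3}{10}(n+2)(n+3)L_n$. A nonzero vector $\Omega$ is a lowest weight vector with lowest weight $(h,w)\in\mathbb{C}^2$ if $L_n\Omega=W_n\Omega=0$ for all $n>0$, $L_0\Omega=h\Omega$ and $W_0\Omega=w\Omega$. The representation is a lowest weight representation if it has a cyclic lowest weight vector (the smallest subspace containing $\Omega$ and invariant under all $L_n,W_n$ is $V$). An inner product (positive definite Hermitian form) is invariant if $\langle L_{-n}x,y\rangle=\langle x,L_ny\rangle$ and $\langle W_{-n}x,y\rangle=\langle x,W_ny\rangle$ for all $x,y\in V$ and $n\in\mathbb{Z}$. ''Generated by the fields $L(z),W(z)$'' means that the state-field correspondence $Y$ satisfies $Y(L_{-2}\Omega,z)=L(z)$ and $Y(W_{-3}\Omega,z)=W(z)$, and that $V$ is spanned by vectors obtained from $\Omega$ by applying the modes of these fields. A vertex operator algebra $(V,Y,\Omega,\nu)$ is simple if it has no ideals other than $\{0\}$ and $V$. It is unitary if there are an inner product $\langle\cdot,\cdot\rangle$ on $V$ with $\langle\Omega,\Omega\rangle=1$ and an antilinear vertex operator algebra automorphism $\theta$ of $V$ (so $\theta\Omega=\Omega$, $\theta\nu=\nu$, $\theta(a_{(n)}b)=(\theta a)_{(n)}\theta b$) such that $\langle Y(e^{zL_1}(-z^{-2})^{L_0}a,z^{-1})u,v\rangle=\langle u,Y(\theta a,z)v\rangle$ for all $a,u,v\in V$, where $z$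 is treated as a real formal variable. *)

(* Defs.v *)
From HB Require Import structures.
From mathcomp Require Import all_boot all_order all_algebra.
From mathcomp Require Import boolp classical_sets fsbigop reals.
From mathcomp Require Import complex.

Set Implicit Arguments.
Unset Strict Implicit.
Unset Printing Implicit Defensive.

Import Order.TTheory GRing.Theory Num.Theory.
Local Open Scope ring_scope.

Section Fields.
Context {R : realType} {V : lmodType R[i]}.

(* The formal series sum_n A_n z^{-n-s} is a field; the condition does not
   depend on the integer shift s. *)
Definition is_field (A : int -> V -> V) : Prop :=
  forall v, exists N : int, forall n, N <= n -> A n v = 0.

Definition commutator (A B : V -> V) (v : V) : V := A (B v) - B (A v).

(* Multiplication by (z - w) of the formal distribution
   sum_{m,n} (D m n) z^{-m-1} w^{-n-1}. *)
Definition mul_zw (D : int -> int -> V) : int -> int -> V :=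
  fun m n => D (m + 1) n - D m (n + 1).

(* (z - w)^N [A(z), B(w)] = 0 for some N *)
Definition local_fields (A B : int -> V -> V) : Prop :=
  exists N : nat, forall (v : V) (m n : int),
    iter N mul_zw (fun p q => commutator (A p) (B q) v) m n = 0.

Definition spanned_by (P : V -> Prop) : Prop :=
  forall v, exists (k : nat) (a : 'I_k -> R[i]) (e : 'I_k -> V),
    (forall i, P (e i)) /\ v = \sum_i a i *: e i.

End Fields.

Section W3.
Context {R : realType} {V : lmodType R[i]}.
Implicit Types (c h w : R[i]) (L W : int -> {linear V -> V}) (Om : V).

Definition virasoro_relations c (L : int -> V -> V) : Prop :=
  forall (m n : int) (v : V),
    commutator (L m) (L n) v =
      (m - n)%:~R *: L (m + n) v
      + (c / 12%:R * (m * (m ^+ 2 - 1))%:~R * (m + n == 0)%:R) *: v.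

(* On every vector both sums have finitely many nonzero terms as soon as
   sum_n L_n z^{-n-2} is a field. *)
Definition Lambda L (n : int) (v : V) : V :=
  \sum_(k \in [set k : int | - 2 < k]%classic) L (n - k) (L k v)
  + \sum_(k \in [set k : int | k <= - 2]%classic) L k (L (n - k) v)
  - (3%:R / 10%:R * ((n + 2) * (n + 3))%:~R) *: L n v.

Definition bsq c : R[i] := 16%:R / (22%:R + 5%:R * c).

Record W3_representation c L W : Prop := {
  W3_fieldL : is_field (fun n => L n);
  W3_fieldW : is_field (fun n => W n);
  W3_LL : virasoro_relations c (fun n => L n);
  W3_LW : forall (m n : int) (v : V),
    commutator (L m) (W n) v = (2 * m - n)%:~R *: W (m + n) v;
  W3_WW : forall (m n : int) (v : V),
    commutator (W m) (W n) v =
      (c / (3 * 5`!)%:R * ((m ^+ 2 - 4) * (m ^+ 2 - 1) * m)%:~R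
         * (m + n == 0)%:R) *: v
      + (bsq c * (m - n)%:~R) *: Lambda L (m + n) v
      + (30%:R^-1 * ((m - n) * (2 * m ^+ 2 - m * n + 2 * n ^+ 2 - 8))%:~R)
          *: L (m + n) v }.

Record lowest_weight_vector L W h w Om : Prop := {
  lwv_neq0 : Om != 0;
  lwv_L_gt0 : forall n : int, 0 < n -> L n Om = 0;
  lwv_W_gt0 : forall n : int, 0 < n -> W n Om = 0;
  lwv_L0 : L 0 Om = h *: Om;
  lwv_W0 : W 0 Om = w *: Om }.

Definition cyclic_vector L W Om : Prop :=
  forall U : {pred V}, submod_closed U -> Om \in U ->
    (forall n v, v \in U -> L n v \in U) ->
    (forall n v, v \in U -> W n v \in U) ->
  forall v, v \in U.

(* {dot V for Num.conj} is the type of positive definite Hermitian forms,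
   linear in the first argument and antilinear in the second. *)
Definition invariant_form L W (f : {dot V for Num.conj}) : Prop :=
  (forall n x y, f (L (- n) x) y = f x (L n y)) /\
  (forall n x y, f (W (- n) x) y = f x (W n y)).

Inductive mode_monomial L W Om : V -> Prop :=
| mode_monomial_vac : mode_monomial L W Om Om
| mode_monomial_L n v : mode_monomial L W Om v -> mode_monomial L W Om (L n v)
| mode_monomial_W n v : mode_monomial L W Om v -> mode_monomial L W Om (W n v).

End W3.

Section VertexAlgebras.
Context {R : realType} {V : lmodType R[i]}.
(* Y a n is the mode a_(n) in Y(a,z) = sum_n a_(n) z^{-n-1}. *)
Implicit Types (Y : V -> int -> V -> V) (Om nu : V) (T : V -> V).

Record vertex_algebra Y Om T : Prop := {
  va_linearl : forall (n : int) (b : V), linear (fun a => Y a n b);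
  va_linearr : forall (a : V) (n : int), linear (Y a n);
  va_linearT : linear T;
  va_field : forall a, is_field (Y a);
  (* [T, Y(a,z)] = d/dz Y(a,z) *)
  va_translation : forall (a : V) (n : int) (b : V),
    commutator T (Y a n) b = - (n%:~R *: Y a (n - 1) b);
  va_TOm : T Om = 0;
  va_vacuum : forall (n : int) (b : V), Y Om n b = (n == -1)%:R *: b;
  (* Y(a,z) Om is regular at z = 0, with value a *)
  va_creation_ge0 : forall (a : V) (n : int), 0 <= n -> Y a n Om = 0;
  va_creation : forall a, Y a (-1) Om = a;
  va_locality : forall a b, local_fields (Y a) (Y b) }.

(* Virasoro modes: Y(nu,z) = sum_n L_n z^{-n-2} *)
Definition vir Y nu (n : int) : V -> V := Y nu (n + 1).

Definition weight_vector Y nu (n : int) (v : V) : Prop :=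
  vir Y nu 0 v = n%:~R *: v.

(* v = sum_{n in s} f n with f n of conformal weight n *)
Definition weight_decomposition Y nu (v : V) (s : seq int) (f : int -> V) :
    Prop :=
  [/\ uniq s, forall n, n \in s -> weight_vector Y nu n (f n)
    & v = \sum_(n <- s) f n].

Record vertex_operator_algebra Y Om T nu : Prop := {
  voa_va : vertex_algebra Y Om T;
  voa_virasoro : exists c : R[i], virasoro_relations c (vir Y nu);
  voa_translation : vir Y nu (-1) =1 T;
  (* V is the sum of the L_0-eigenspaces V_n, n integer; the sum of eigenspaces
     for distinct eigenvalues is automatically direct. *)
  voa_graded : forall v, exists s f, weight_decomposition Y nu v s f;
  voa_bounded_below : exists N : int, forall (n : int) (v : V),
    n < N -> weight_vector Y nu n v -> v = 0;
  voa_finite_dim : forall n : int, exists (k : nat) (e : 'I_k -> V),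
    forall v, weight_vector Y nu n v ->
      exists a : 'I_k -> R[i], v = \sum_i a i *: e i }.

(* In a vertex operator algebra such a subspace is invariant under the
   translation operator nu_(0), and by skew-symmetry it is two-sided. *)
Definition voa_ideal Y (J : {pred V}) : Prop :=
  submod_closed J /\ forall a n b, b \in J -> Y a n b \in J.

Definition simple_voa Y : Prop :=
  forall J : {pred V}, voa_ideal Y J -> J =i pred1 0 \/ J =i predT.

(* The coefficient of z^{-k-1} in Y(e^{z L_1} (-z^{-2})^{L_0} a, z^{-1}) u, for
   a = sum_{n in s} f n with f n of weight n: one has
     e^{z L_1} (-z^{-2})^{L_0} (f n)
       = (-1)^n sum_j z^{j-2n} / j! L_1^j (f n)
   and b_(m) occurs in Y(b, z^{-1}) with z^{m+1}, so m = 2n - j - k - 2.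
   The sum over j is finite since L_1 lowers the weight by one. *)
Definition adjoint_mode Y nu (s : seq int) (f : int -> V) (k : int) (u : V) :
    V :=
  \sum_(n <- s) (-1 : R[i]) ^ n *:
    \sum_(j \in [set: nat]%classic)
      (j`!%:R : R[i])^-1 *:
        Y (iter j (vir Y nu 1) (f n)) (2 * n - j%:Z - k - 2) u.

Record antilinear_automorphism Y Om nu (theta : V -> V) : Prop := {
  aut_antilinear : forall (k : R[i]) (a b : V),
    theta (k *: a + b) = Num.conj k *: theta a + theta b;
  aut_bij : bijective theta;
  aut_vacuum : theta Om = Om;
  aut_conformal : theta nu = nu;
  aut_modes : forall (a : V) (n : int) (b : V),
    theta (Y a n b) = Y (theta a) n (theta b) }.

Definition unitary_voa Y Om nu : Prop :=
  exists (f : {dot V for Num.conj}) (theta : V -> V),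
    [/\ f Om Om = 1,
        antilinear_automorphism Y Om nu theta
      & forall a s g, weight_decomposition Y nu a s g ->
          forall (u v : V) (k : int),
            f (adjoint_mode Y nu s g k u) v = f u (Y (theta a) k v)].

End VertexAlgebras.

Section Generation.
Context {R : realType} {V : lmodType R[i]}.

(* Y(L_{-2} Om, z) = sum_n L_n z^{-n-2} and Y(W_{-3} Om, z) = sum_n W_n z^{-n-3} *)
Record generated_by (Y : V -> int -> V -> V) (Om : V)
    (L W : int -> {linear V -> V}) : Prop := {
  gen_L : forall (n : int) (v : V), Y (L (- 2) Om) (n + 1) v = L n v;
  gen_W : forall (n : int) (v : V), Y (W (- 3) Om) (n + 2) v = W n v;
  gen_span : spanned_by (mode_monomial L W Om) }.

End Generation.

(* Main.v *)
Require Import Defs.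
From HB Require Import structures.
From mathcomp Require Import all_boot all_order all_algebra.
From mathcomp Require Import boolp classical_sets functions fsbigop reals.
From mathcomp Require Import complex.
From mathcomp Require Import zify ring.

Import Order.TTheory GRing.Theory Num.Theory.
Local Open Scope ring_scope.

Set Implicit Arguments.
Unset Strict Implicit.
Unset Printing Implicit Defensive.

(** The vertex algebra is obtained by identifying V with a space of fields.
    Call a field A(z) a state field if it is translation covariant for L_{-1}, if
    A(z) Om is regular at z = 0, and if it is local with L(z) and W(z).  A
    state field with A_(-1) Om = 0 kills Om, and then, by locality, all
    vectors that the modes of L(z) and W(z) produce from Om, hence V
    ([state_field_eq0]); so A is determined by the vector A_(-1) Om.
    Conversely n-th products with L(z) and W(z) preserve these conditions, by
    Dong's lemma ([dong]), and (A_(n) B)_(-1) Om = A_n (B_(-1) Om); as Om is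
    cyclic every vector comes from a state field.  The inverse
    bijection is the state-field correspondence ([reconstruction]).  Locality
    of L(z) and W(z) holds because the structure constants of their
    commutators are polynomials in the mode numbers, apart from factors that
    depend on their sum only.

    Commutators lower the degree for which L has degree 1 and W has degree 2,
    because the composite field in [W, W] has degree 2 < 4.  Therefore V is
    spanned by words in the modes L_{-n}, W_{-n} with n > 0 applied to Om
    ([straighten]), and this gives the grading by nonnegative integers with
    finite-dimensional pieces.

    Now let the representation be unitary.  The central charge is real, so
    conjugating scalars and replacing W by -W preserves the relations.  The
    straightening argument, applied to V plus its complex conjugate and to the
    vector (Om, Om), shows that this symmetry preserves the inner product up to
    conjugation; since the form is nondegenerate, it defines an antilinear
    involution theta of V ([conjugation_exists]), which is an automorphism
    because state fields are unique ([theta_Y]).  The invariance of the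
    form is proved by induction on the state a.  The step from a to x_(m) a,
    with x one of the two generating vectors, of weight d, commutes powers of
    L_1 with x_(m); this produces the coefficients C(2d-2-m, l), and the
    resulting sum is the right-hand side of the Borcherds identity
    ([borcherds_identity], [opposite_gen]).  Finally an ideal that does not
    contain Om is stable under L_0 and so orthogonal to Om, hence orthogonal
    to everything that the modes produce from Om, and is therefore zero
    ([W3_simple_voa]). *)

(** * Binomial coefficients with integral upper index *)

(** The upper index -(n+1), n >= 0, gives (-1)^j C(n+j, j). *)
Definition gbin (n : int) (j : nat) : int :=
  match n with
  | Posz n => 'C(n, j)%:Z
  | Negz n => (-1) ^+ j * 'C(n + j, j)%:Z
  end.

Lemma gbin0 n : gbin n 0 = 1.
Proof. by case: n => n /=; rewrite bin0 ?expr0 ?mulr1. Qed.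

Lemma gbinS n j : gbin (n + 1) j.+1 = gbin n j.+1 + gbin n j.
Proof.
case: n => [n|[|n]].
- by rewrite -PoszD addn1 /= binS PoszD.
- by rewrite /= !add0n !binn !mulr1 exprS mulN1r addNr.
- have -> : Negz n.+1 + 1 = Negz n by rewrite !NegzE; lia.
  by rewrite /= !addSn !addnS (binS (n + j).+1) PoszD exprS; ring.
Qed.

Lemma gbin_absorb n j : gbin n j.+1 * j.+1%:Z = (n - j%:Z) * gbin n j.
Proof.
case: n => n /=.
- have [le_jn|lt_nj] := leqP j n.
    by rewrite subzn // -!PoszM mulnC mul_bin_left.
  by rewrite !bin_small ?mul0r ?mulr0 // ltnW.
- have E : 'C((n + j).+1, j.+1)%:Z * j.+1%:Z = (n + j).+1%:Z * 'C(n + j, j)%:Z.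
    by rewrite -!PoszM mulnC -mul_bin_diag.
  rewrite addnS -mulrA E NegzE exprS.
  have -> : - Posz n.+1 - j%:Z = - Posz (n + j).+1 by lia.
  by ring.
Qed.

(** Coefficients of the binomial series of (1 - x)^n. *)
Definition sbin (n : int) (j : nat) : int := (-1) ^+ j * gbin n j.

Lemma sbin0 n : sbin n 0 = 1.
Proof. by rewrite /sbin gbin0 mulr1. Qed.

Lemma sbinS n j : sbin (n + 1) j.+1 = sbin n j.+1 - sbin n j.
Proof. by rewrite /sbin gbinS exprS; ring. Qed.

Lemma sbin_absorb n j : sbin n j.+1 * j.+1%:Z = (j%:Z - n) * sbin n j.
Proof. by rewrite /sbin -mulrA gbin_absorb exprS; ring. Qed.

Lemma sbin0n j : sbin 0 j = (j == 0)%N%:Z.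
Proof. by case: j => [|j]; rewrite /sbin /= ?bin0n ?mulr0 ?bin0. Qed.

Section FiniteSums.
Context {M : zmodType}.

Lemma fsum_ord (f : nat -> M) (N : nat) :
  (forall j, (N <= j)%N -> f j = 0) ->
  \sum_(j \in [set: nat]%classic) f j = \sum_(j < N) f j.
Proof.
move=> f0; rewrite -(big_mkord xpredT f) (fsbigE (index_iota 0 N)) ?iota_uniq //.
- by apply: eq_bigl => j; rewrite in_setT.
- by move=> j _; rewrite mem_index_iota /= -leqNgt => /f0.
Qed.

End FiniteSums.

(** * Formal distributions and multiplication by differences of variables *)

Lemma subrACA (M : zmodType) (a b c d : M) : a - b - (c - d) = a - c - (b - d).
Proof. by rewrite opprD addrACA -opprD. Qed.

Section Distributions.
Context {R : realType} {V : lmodType R[i]}.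
Implicit Types (D E : int -> int -> V).

Lemma iter_mul_zw_ext N D E : (forall m n, D m n = E m n) ->
  forall m n, iter N mul_zw D m n = iter N mul_zw E m n.
Proof. by move=> DE; elim: N => //= N IH m n; rewrite /mul_zw !IH. Qed.

Lemma iter_mul_zwP N (a : R[i]) D E m n :
  iter N mul_zw (fun p q => a *: D p q + E p q) m n =
  a *: iter N mul_zw D m n + iter N mul_zw E m n.
Proof.
elim: N m n => //= N IH m n.
by rewrite /mul_zw !IH opprD addrACA -scalerBr.
Qed.

Lemma iter_mul_zw0 N D : (forall m n, D m n = 0) ->
  forall m n, iter N mul_zw D m n = 0.
Proof. by move=> D0; elim: N => //= N IH m n; rewrite /mul_zw !IH subr0. Qed.

Lemma iter_mul_zw_leq N N' D : (N <= N')%N ->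
  (forall m n, iter N mul_zw D m n = 0) ->
  forall m n, iter N' mul_zw D m n = 0.
Proof.
by move=> /subnK <- D0; rewrite iterD; apply: iter_mul_zw0.
Qed.

Lemma iter_mul_zw_swap N D m n :
  iter N mul_zw (fun p q => D q p) m n = (-1) ^+ N *: iter N mul_zw D n m.
Proof.
elim: N m n => [|N IH] m n /=; first by rewrite expr0 scale1r.
by rewrite /mul_zw !IH exprS mulN1r scaleNr -scalerBr -scalerN opprB.
Qed.

Lemma iter_mul_zw_shift N D a b m n :
  iter N mul_zw (fun p q => D (p + a) (q + b)) m n = iter N mul_zw D (m + a) (n + b).
Proof.
by elim: N m n => //= N IH m n; rewrite /mul_zw !IH !(addrAC _ 1).
Qed.

(** Multiplication by (z - w)^N is injective on distributions whose
    coefficients vanish for large n.  For N = 1 a distribution in the kernel is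
    constant along antidiagonals, and each antidiagonal meets the region where
    it vanishes. *)
Lemma iter_mul_zw_eq0 N D :
  (forall m n, iter N mul_zw D m n = 0) ->
  (exists n0 : int, forall m n, n0 <= n -> D m n = 0) ->
  forall m n, D m n = 0.
Proof.
elim: N D => [|N IH] D D0 [n0 Dn0]; first exact: D0.
have MD0 : forall m n, mul_zw D m n = 0.
  apply: IH => [m n|]; first by rewrite -iterSr.
  by exists n0 => m n n0n; rewrite /mul_zw !Dn0 ?subr0 //; lia.
have shift t m n : D m n = D (m - t%:Z) (n + t%:Z).
  elim: t m n => [|t IHt] m n; first by rewrite subr0 addr0.
  rewrite IHt; have /eqP := MD0 (m - t.+1%:Z) (n + t%:Z).
  rewrite /mul_zw subr_eq0 => /eqP.
  have -> : m - t.+1%:Z + 1 = m - t%:Z by lia.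
  by have -> : n + t%:Z + 1 = n + t.+1%:Z by lia.
move=> m n; rewrite (shift `|n0 - n|%N); apply: Dn0; lia.
Qed.

End Distributions.

Section ThreeVariables.
Context {R : realType} {V : lmodType R[i]}.
Let dist3 := int -> int -> int -> V.
Implicit Types (G : dist3).

(** Multiplication by z1 - z2, z1 - z3 and z2 - z3 in three variables. *)
Definition mul12 G : dist3 := fun k m l => G (k + 1) m l - G k (m + 1) l.
Definition mul13 G : dist3 := fun k m l => G (k + 1) m l - G k m (l + 1).
Definition mul23 G : dist3 := fun k m l => G k (m + 1) l - G k m (l + 1).

Lemma mul23E G : mul23 G = mul13 G - mul12 G.
Proof.
apply/funext => k; apply/funext => m; apply/funext => l.
by rewrite !fctE /mul23 /mul13 /mul12 opprB addrC addrA subrK.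
Qed.

Lemma mul12_13 G : mul12 (mul13 G) = mul13 (mul12 G).
Proof. by do 3![apply/funext => ?]; apply: subrACA. Qed.

Lemma mul12_23 G : mul12 (mul23 G) = mul23 (mul12 G).
Proof. by do 3![apply/funext => ?]; apply: subrACA. Qed.

Lemma mul13_23 G : mul13 (mul23 G) = mul23 (mul13 G).
Proof. by do 3![apply/funext => ?]; apply: subrACA. Qed.

Lemma mul12B : zmod_morphism mul12.
Proof. by move=> G H; do 3![apply/funext => ?]; apply: subrACA. Qed.

Lemma mul13B : zmod_morphism mul13.
Proof. by move=> G H; do 3![apply/funext => ?]; apply: subrACA. Qed.

Lemma mul23B : zmod_morphism mul23.
Proof. by move=> G H; do 3![apply/funext => ?]; apply: subrACA. Qed.

Lemma iter_mul13_eval N G k m l :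
  iter N mul13 G k m l = iter N mul_zw (fun p q => G p m q) k l.
Proof. by elim: N k l => //= N IH k l; rewrite /mul13 /mul_zw !IH. Qed.

Lemma iter_mul23_eval N G k m l :
  iter N mul23 G k m l = iter N mul_zw (G k) m l.
Proof. by elim: N m l => //= N IH m l; rewrite /mul23 /mul_zw !IH. Qed.

End ThreeVariables.

Section CommutingOperators.
Context {U : zmodType}.
Implicit Types (x y : U -> U).

Lemma iter_zmod_morphism n x : zmod_morphism x -> zmod_morphism (iter n x).
Proof. by move=> xB; elim: n => [|n IH] g h //=; rewrite IH xB. Qed.

Lemma zmod_morphism0 x : zmod_morphism x -> x 0 = 0.
Proof. by move=> xB; rewrite -[0 in LHS](subrr 0) xB subrr. Qed.

Lemma iter_comm n x y g : (forall h, x (y h) = y (x h)) ->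
  iter n x (y g) = y (iter n x g).
Proof. by move=> xy; elim: n => //= n ->. Qed.

Lemma iter_iter_comm n m x y g : (forall h, x (y h) = y (x h)) ->
  iter n x (iter m y g) = iter m y (iter n x g).
Proof. by move=> xy; elim: m => //= m <-; apply: iter_comm. Qed.

(** Every term in the binomial expansion of (y - x)^(a+b) contains x^a or y^b. *)
Lemma iter_sub_eq0 x y z a b g :
  zmod_morphism x -> zmod_morphism y -> zmod_morphism z ->
  (forall h, x (y h) = y (x h)) -> (forall h, z h = y h - x h) ->
  iter a x g = 0 -> iter b y g = 0 -> iter (a + b) z g = 0.
Proof.
move=> xB yB zB xy zE; move sE : (a + b)%N => s.
elim: s a b g sE => [|s IH] [|a] [|b] g //= sE.
- by move=> -> _; rewrite -iterS (zmod_morphism0 (iter_zmod_morphism s.+1 zB)).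
- by move=> _ ->; rewrite -iterS (zmod_morphism0 (iter_zmod_morphism s.+1 zB)).
move=> ag bg; rewrite -iterS iterSr zE (iter_zmod_morphism s zB).
rewrite (IH a.+1 b) ?(IH a b.+1) ?subrr //; try lia.
- by rewrite -iterSr.
- by rewrite (@iter_comm b.+1 y x g) //= bg zmod_morphism0.
- by rewrite (@iter_comm a.+1 x y g) //= ag zmod_morphism0.
- by rewrite -iterSr.
Qed.

End CommutingOperators.

Section EventualEquality.
Context {R : realType} {V : lmodType R[i]}.
Let dist3 := int -> int -> int -> V.

(** Pointwise stabilisation.  The sums in n-th products are infinite, but
    finite on each vector; multiplication by differences of variables involves
    finitely many coefficients and so passes to partial sums. *)
Definition tends_to (G_ : nat -> dist3) (G : dist3) :=
  forall k m l, exists J0, forall J, (J0 <= J)%N -> G_ J k m l = G k m l.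

Lemma tends_to_sub (G_ : nat -> dist3) G (k m l k' m' l' : int) :
  tends_to G_ G -> exists J0, forall J, (J0 <= J)%N ->
   G_ J k m l - G_ J k' m' l' = G k m l - G k' m' l'.
Proof.
move=> GG; have [a aP] := GG k m l; have [b bP] := GG k' m' l'.
by exists (a + b)%N => J J0; rewrite aP ?bP //; lia.
Qed.

Lemma tends_to_mul13 N G_ G :
  tends_to G_ G -> tends_to (fun J => iter N mul13 (G_ J)) (iter N mul13 G).
Proof.
move=> GG; elim: N => //= N IH k m l.
exact: (tends_to_sub (k + 1) m l k m (l + 1) IH).
Qed.

Lemma tends_to_mul23 N G_ G :
  tends_to G_ G -> tends_to (fun J => iter N mul23 (G_ J)) (iter N mul23 G).
Proof.
move=> GG; elim: N => //= N IH k m l.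
exact: (tends_to_sub k (m + 1) l k m (l + 1) IH).
Qed.

Lemma tends_to0 G_ G : tends_to G_ G -> (forall J, G_ J = 0) -> G = 0.
Proof.
move=> GG G0; apply/funext => k; apply/funext => m; apply/funext => l.
by have [J JP] := GG k m l; rewrite -(JP J (leqnn J)) G0.
Qed.

End EventualEquality.

(** * Fields, their n-th products and the Borcherds identity *)

Section FieldProducts.
Context {R : realType} {V : lmodType R[i]}.

(** The field is the series of A_n z^(-n-1). *)
Record fld := Fld {
  mode :> int -> {linear V -> V};
  fldP : is_field (fun n => mode n) }.

Definition linear_of (f : V -> V) (fL : linear f) : V -> V := f.

HB.instance Definition _ f fL :=
  GRing.isLinear.Build _ _ _ _ (@linear_of f fL) fL.

Definition mkfld (A : int -> V -> V) (AL : forall n, linear (A n))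
  (AF : is_field A) : fld := @Fld (fun n => linear_of (AL n)) AF.

Implicit Types (A B D : fld) (v : V) (n k m l : int).

Lemma fld_bound A v m : exists J, forall j, (J <= j)%N -> A (m + j%:Z) v = 0.
Proof.
have [N NP] := fldP A v; exists `|N - m|%N => j Jj; apply: NP; lia.
Qed.

Definition flocal A B := local_fields (fun n => A n) (fun n => B n).

(** The coefficient of z^(-k-1) w^(-m-1) in (z - w)^n A(z) B(w) v, with
    (z - w)^n expanded for |z| > |w|. *)
Definition expansion A B n k m v : V :=
  \sum_(j \in [set: nat]%classic) A (n + k - j%:Z) (B (m + j%:Z) v) *~ sbin n j.

(** The coefficient of z^(-k-1) w^(-m-1) in the difference of
    (z - w)^n A(z) B(w), expanded for |z| > |w|, and (z - w)^n B(w) A(z),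
    expanded for |w| > |z|. *)
Definition borcherds A B n k m v : V :=
  expansion A B n k m v - (-1) ^ n *: expansion B A n m k v.

Lemma expansionE A B n k m v (J : nat) :
  (forall j, (J <= j)%N -> B (m + j%:Z) v = 0) ->
  expansion A B n k m v =
    \sum_(j < J) A (n + k - j%:Z) (B (m + j%:Z) v) *~ sbin n j.
Proof.
by move=> BJ; apply: fsum_ord => j Jj; rewrite BJ // linear0 mul0rz.
Qed.

Lemma expansion_bound A B m v : exists J0, forall J, (J0 <= J)%N -> forall n k,
  expansion A B n k m v =
    \sum_(j < J) A (n + k - j%:Z) (B (m + j%:Z) v) *~ sbin n j.
Proof.
have [J0 JP] := fld_bound B v m; exists J0 => J J0J n k.
by apply: expansionE => j Jj; rewrite JP //; lia.
Qed.

Lemma expansion0 A B k m v : expansion A B 0 k m v = A k (B m v).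
Proof.
have [J0 JP] := expansion_bound A B m v.
rewrite (JP J0.+1) // big_ord_recl big1 => [|j _].
  by rewrite sbin0n addr0 add0r subr0 addr0.
by rewrite sbin0n.
Qed.

(** Pascal's rule for the coefficients of (z - w)^n. *)
Lemma expansionS A B n k m v :
  expansion A B (n + 1) k m v =
    expansion A B n (k + 1) m v - expansion A B n k (m + 1) v.
Proof.
have [J JP] := fld_bound B v m.
rewrite (@expansionE _ _ _ _ _ _ J.+1); last by move=> j ?; rewrite JP //; lia.
rewrite (@expansionE _ _ _ _ _ _ J.+1); last by move=> j ?; rewrite JP //; lia.
rewrite (@expansionE _ _ _ _ _ _ J); last first.
  by move=> j ?; rewrite -addrA (JP (1 + j)%N) //; lia.
rewrite !big_ord_recl !sbin0 -[RHS]addrA -sumrB; congr (_ + _).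
  by congr (A _ _); lia.
apply: eq_bigr => j _; rewrite lift0 sbinS mulrzBr.
have -> : n + 1 + k - j.+1%:Z = n + k - j%:Z by lia.
have -> : n + (k + 1) - j.+1%:Z = n + k - j%:Z by lia.
by have -> : m + 1 + j%:Z = m + j.+1%:Z by lia.
Qed.

(** Multiplication by z - w raises the exponent n. *)
Lemma borcherdsS A B n k m v :
  borcherds A B (n + 1) k m v =
    borcherds A B n (k + 1) m v - borcherds A B n k (m + 1) v.
Proof.
rewrite /borcherds !expansionS subrACA; congr (_ - _).
rewrite expfzDr ?oppr_eq0 ?oner_eq0 // expr1z mulrN1 scaleNr -scalerN opprB.
by rewrite scalerBr.
Qed.

Lemma borcherds0 A B k m v :
  borcherds A B 0 k m v = commutator (A k) (B m) v.
Proof. by rewrite /borcherds !expansion0 expr0z scale1r. Qed.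

Lemma borcherds_iter A B n N k m v :
  iter N mul_zw (fun p q => borcherds A B n p q v) k m =
  borcherds A B (n + N%:Z) k m v.
Proof.
elim: N k m => [|N IH] k m; first by rewrite addr0.
rewrite /= /mul_zw !IH -borcherdsS.
by have -> : n + N%:Z + 1 = n + N.+1%:Z by lia.
Qed.

(** For large n the two expansions agree: this is a reformulation of
    locality. *)
Lemma borcherds_local A B : flocal A B ->
  exists N : nat, forall n k m v, N%:Z <= n -> borcherds A B n k m v = 0.
Proof.
case=> N NP; exists N => n k m v Nn.
have -> : n = 0 + `|n|%N%:Z by lia.
rewrite -borcherds_iter.
apply: (@iter_mul_zw_leq _ _ N) => [|p q]; first lia.
rewrite -[RHS](NP v p q); apply: iter_mul_zw_ext => *; exact: borcherds0.
Qed.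

Lemma borcherds_linear A B n k m : linear (borcherds A B n k m).
Proof.
have expL A' B' n' k' m' : linear (expansion A' B' n' k' m').
  move=> a u v.
  have [Ju uP] := expansion_bound A' B' m' u.
  have [Jv vP] := expansion_bound A' B' m' v.
  have [Jw wP] := expansion_bound A' B' m' (a *: u + v).
  pose J := (Ju + Jv + Jw)%N.
  rewrite (uP J) ?(vP J) ?(wP J) /J; try lia.
  rewrite scaler_sumr -big_split; apply: eq_bigr => j _ /=.
  by rewrite !linearP mulrzDl scalerMzr.
move=> a u v; rewrite /borcherds !expL !scalerDr scalerN !scalerA.
by rewrite (mulrC a) opprD addrACA.
Qed.

Lemma fld_bound_fin A (J : nat) (u : nat -> V) :
  exists N : int, forall j n, (j < J)%N -> N <= n -> A n (u j) = 0.
Proof.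
elim: J => [|J [N NP]]; first by exists 0.
have [N' N'P] := fldP A (u J); exists (`|N| + `|N'|) => j n.
rewrite ltnS leq_eqVlt => /predU1P[->|jJ] Nn; first by apply: N'P; lia.
by apply: NP => //; lia.
Qed.

Lemma borcherds_is_field A B n : is_field (fun m => borcherds A B n 0 m).
Proof.
move=> v; have [M MP] := fldP B v.
have [J JP] := fld_bound A v 0.
have [N NP] := fld_bound_fin B J (fun j => A (0 + j%:Z) v).
exists (`|M| + `|N| + J%:Z + `|n|) => m mP.
rewrite /borcherds (@expansionE _ _ _ _ _ _ 0); last first.
  by move=> j _; apply: MP; lia.
rewrite (@expansionE _ _ _ _ _ _ J) // big_ord0 sub0r big1 ?scaler0 ?oppr0 //.
by move=> j _; rewrite NP ?mul0rz //; have := ltn_ord j; lia.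
Qed.

(** The n-th product A_(n) B is the residue in z of the difference of the two
    expansions. *)
Definition nprod A n B : fld :=
  mkfld (fun m => borcherds_linear A B n 0 m) (borcherds_is_field A B n).

Lemma nprodE A n B m v : nprod A n B m v = borcherds A B n 0 m v.
Proof. by []. Qed.

(** Both sides satisfy the recurrence of [borcherdsS], vanish for large n by
    locality and agree for k = 0.  Descending induction on n: once the
    difference vanishes at n + 1, its value at n depends on k + m only, and can
    be computed at k = 0. *)
Lemma borcherds_identity A B n k m v : flocal A B ->
  borcherds A B n k m v =
    \sum_(l \in [set: nat]%classic) nprod A (n + l%:Z) B (m + k - l%:Z) v *~ gbin k l.
Proof.
move=> /borcherds_local [N NP].
pose S n k m := \sum_(l \in [set: nat]%classic)
  nprod A (n + l%:Z) B (m + k - l%:Z) v *~ gbin k l.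
have SE J n' k' m' : N%:Z <= n' + J%:Z -> S n' k' m' = \sum_(l < J)
    nprod A (n' + l%:Z) B (m' + k' - l%:Z) v *~ gbin k' l.
  move=> JN; apply: fsum_ord => l Jl; rewrite nprodE NP ?mul0rz //; lia.
have S0 n' m' : S n' 0 m' = borcherds A B n' 0 m' v.
  rewrite (SE (`|N%:Z - n'|%N).+1); last by lia.
  rewrite big_ord_recl big1 => [|l _]; last by rewrite lift0 /= mulr0z.
  rewrite addr0 gbin0 mulr1z nprodE.
  have -> : n' + (ord0 : 'I_(`|N%:Z - n'|%N).+1)%:Z = n' by rewrite /=; lia.
  by have -> : m' + 0 - (ord0 : 'I_(`|N%:Z - n'|%N).+1)%:Z = m' by rewrite /=; lia.
have SS n' k' m' : S (n' + 1) k' m' = S n' (k' + 1) m' - S n' k' (m' + 1).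
  pose J := `|N%:Z - n'|%N.
  rewrite (SE J) ?(SE J.+1 n'); try lia.
  rewrite !big_ord_recl !gbin0.
  have -> : m' + 1 + k' = m' + (k' + 1) by lia.
  rewrite opprD addrACA subrr add0r -sumrB; apply: eq_bigr => l _.
  rewrite lift0 gbinS mulrzDr. rewrite [RHS]addrAC subrr add0r.
  have -> : n' + l.+1%:Z = n' + 1 + l%:Z by lia.
  by have -> : m' + (k' + 1) - l.+1%:Z = m' + k' - l%:Z by lia.
have E0 t : forall n' k' m', N%:Z <= n' + t%:Z ->
    borcherds A B n' k' m' v = S n' k' m'.
  elim: t => [|t IH] n' k' m' Nn.
    by rewrite NP ?(SE 0) ?big_ord0; try lia.
  have step k1 m1 : borcherds A B n' (k1 + 1) m1 v - S n' (k1 + 1) m1 =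
      borcherds A B n' k1 (m1 + 1) v - S n' k1 (m1 + 1).
    have /eqP := IH (n' + 1) k1 m1 ltac:(lia).
    rewrite borcherdsS SS -subr_eq0 subrACA subr_eq0 => /eqP //.
  have down s k1 m1 : borcherds A B n' k1 m1 v - S n' k1 m1 =
      borcherds A B n' (k1 - s%:Z) (m1 + s%:Z) v - S n' (k1 - s%:Z) (m1 + s%:Z).
    elim: s => [|s IHs]; first by rewrite subr0 addr0.
    rewrite IHs; have -> : k1 - s%:Z = k1 - s.+1%:Z + 1 by lia.
    by rewrite step; have -> : m1 + s%:Z + 1 = m1 + s.+1%:Z by lia.
  apply/eqP; rewrite -subr_eq0.
  have zero m1 : borcherds A B n' 0 m1 v - S n' 0 m1 = 0.
    by rewrite S0 subrr.
  case: k' => s; first by rewrite (down s) subrr zero.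
  have := down s.+1 0 (m' - s.+1%:Z).
  by rewrite zero sub0r subrK -NegzE => <-.
by apply: (E0 `|N%:Z - n|%N); lia.
Qed.

End FieldProducts.

Arguments linear_of {R V} f fL /.

(** * Dong's lemma *)

Section Locality.
Context {R : realType} {V : lmodType R[i]}.
Implicit Types (A B D : @fld R V) (v : V) (n k m l : int).

Lemma flocal_sym A B : flocal A B -> flocal B A.
Proof.
case=> N NP; exists N => v m n.
have E p q : commutator (B p) (A q) v =
    (-1 : R[i]) *: commutator (A q) (B p) v + 0.
  by rewrite addr0 scaleN1r opprB.
rewrite (iter_mul_zw_ext _ E) iter_mul_zwP.
rewrite (iter_mul_zw_swap N (fun p q => commutator (A p) (B q) v)) NP !scaler0.
by rewrite add0r iter_mul_zw0.
Qed.

Section Dong.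
Variables (A B D : @fld R V).
Hypotheses (AB : flocal A B) (AD : flocal A D) (BD : flocal B D).

Let triple A B v : int -> int -> int -> V := fun k m l =>
  A k (B m (D l v)) - D l (A k (B m v)).

Let shift (z : R[i]) (a b : int) (G : int -> int -> int -> V) : int -> int -> int -> V :=
  fun k m l => z *: G (a + k) (b + m) l.

Let shift13 N z a b G : iter N mul13 (shift z a b G) = shift z a b (iter N mul13 G).
Proof.
apply: iter_comm => H; apply/funext => k; apply/funext => m; apply/funext => l.
by rewrite /mul13 /shift scalerBr !addrA.
Qed.

Let shift23 N z a b G : iter N mul23 (shift z a b G) = shift z a b (iter N mul23 G).
Proof.
apply: iter_comm => H; apply/funext => k; apply/funext => m; apply/funext => l.
by rewrite /mul23 /shift scalerBr !addrA.
Qed.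

Let kill N (G : int -> int -> int -> V) : int -> int -> int -> V :=
  iter N mul13 (iter N mul23 G).

Let killB N : zmod_morphism (kill N).
Proof.
move=> G H; rewrite /kill (iter_zmod_morphism N mul23B).
by rewrite (iter_zmod_morphism N mul13B).
Qed.

Let triple_killed A' B' : flocal A' D -> flocal B' D ->
  exists N, forall N', (N <= N')%N -> forall v, kill N' (triple A' B' v) = 0.
Proof.
move=> [N1 AD'] [N2 BD']; exists (N1 + N2)%N => N le_N v.
pose G1 k m l := A' k (commutator (B' m) (D l) v).
pose G2 k m l := - commutator (A' k) (D l) (B' m v).
have -> : triple A' B' v = G1 - G2.
  do 3![apply/funext => ?]; rewrite /triple !fctE /G1 /G2 /commutator.
  by rewrite linearB opprK addrA subrK.
rewrite killB.
have -> : kill N G1 = 0.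
  rewrite /kill; have -> : iter N mul23 G1 = 0.
    apply/funext => k; apply/funext => m; apply/funext => l.
    rewrite iter_mul23_eval.
    have K p q : iter N mul_zw (G1 k) p q =
        A' k (iter N mul_zw (fun m l => commutator (B' m) (D l) v) p q).
      elim: (N) p q => //= N' IH p q.
      by rewrite /mul_zw !IH linearB.
    rewrite K (iter_mul_zw_leq _ (BD' v)) ?linear0 //; lia.
  exact: zmod_morphism0 (iter_zmod_morphism N mul13B).
have -> : kill N G2 = 0.
  rewrite /kill (iter_iter_comm _ _ _ mul13_23).
  have -> : iter N mul13 G2 = 0.
    apply/funext => k; apply/funext => m; apply/funext => l.
    rewrite iter_mul13_eval.
    have E p q : G2 p m q = (-1 : R[i]) *: commutator (A' p) (D q) (B' m v) + 0.
      by rewrite addr0 scaleN1r.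
    rewrite (iter_mul_zw_ext _ E) iter_mul_zwP [X in _ + X]iter_mul_zw0 // addr0.
    by rewrite (iter_mul_zw_leq _ (AD' (B' m v))) ?scaler0 //; lia.
  exact: zmod_morphism0 (iter_zmod_morphism N mul23B).
by rewrite subrr.
Qed.


Let dist (n : int) A B v : int -> int -> int -> V := fun k m l =>
  expansion A B n k m (D l v) - D l (expansion A B n k m v).

Let dist_killed n N A' B' v : kill N (triple A' B' v) = 0 ->
  kill N (dist n A' B' v) = 0.
Proof.
move=> T0.
pose S J : int -> int -> int -> V := fun k m l =>
  \sum_(j < J) triple A' B' v (n - j%:Z + k) (j%:Z + m) l *~ sbin n j.
have SK J : kill N (S J) = 0.
  elim: J => [|J IH].
    have -> : S 0 = 0.
      apply/funext => k; apply/funext => m; apply/funext => l.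
      by rewrite /S big_ord0.
    exact: zmod_morphism0 (killB N).
  have -> : S J.+1 = S J - shift (- (sbin n J)%:~R) (n - J%:Z) J (triple A' B' v).
    apply/funext => k; apply/funext => m; apply/funext => l.
    by rewrite /S big_ord_recr !fctE /shift /= scaleNr scaler_int opprK.
  rewrite killB IH sub0r /kill shift23 shift13 -/(kill N _) T0.
  by apply/funext => k; apply/funext => m; apply/funext => l; rewrite /shift !fctE scaler0 oppr0.
have ST : tends_to S (dist n A' B' v).
  move=> k m l.
  have [J1 P1] := expansion_bound A' B' m (D l v).
  have [J2 P2] := expansion_bound A' B' m v.
  exists (J1 + J2)%N => J le_J.
  rewrite /dist (P1 J) ?(P2 J); try lia.
  rewrite linear_sum -sumrB; apply: eq_bigr => j _ /=.
  rewrite raddfMz -mulrzBl.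
  have -> : n + k - j%:Z = n - j%:Z + k by lia.
  by rewrite (addrC m).
apply: (@tends_to0 _ _ (fun J => kill N (S J))) => [|J]; last exact: SK.
by apply: tends_to_mul13; apply: tends_to_mul23.
Qed.

Let swap (G : int -> int -> int -> V) : int -> int -> int -> V :=
  fun k m l => G m k l.

Let kill_swap N G : kill N (swap G) = swap (kill N G).
Proof.
have s23 H : iter N mul23 (swap H) = swap (iter N mul13 H).
  by elim: (N) => //= n ->.
have s13 H : iter N mul13 (swap H) = swap (iter N mul23 H).
  by elim: (N) => //= n ->.
by rewrite /kill s23 s13 (iter_iter_comm _ _ _ mul13_23).
Qed.

(** Let G be the distribution of commutators of D(z3) with the expansions that
    define A_(n) B.  High powers of z1 - z2 kill G because A and B are local;
    (z1 - z3)^N (z2 - z3)^N kills each product A(z1) B(z2) and B(z2) A(z1)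
    commuted with D(z3), hence also G.  As z2 - z3 = (z1 - z3) - (z1 - z2), a
    power of z2 - z3 kills G. *)
Theorem dong n : flocal (nprod A n B) D.
Proof.
have [N1 K1] := triple_killed AD BD.
have [N2 K2] := triple_killed BD AD.
have [N3 K3] := borcherds_local AB.
pose N := (N1 + N2)%N; pose a := `|N3%:Z - n|%N.
(* N powers of z2 - z3 serve for the locality with D, a + N for the binomial
   argument. *)
exists (a + N + N)%N => v m l.
pose G k m l : V := commutator (borcherds A B n k m) (D l) v.
have GE : G = dist n A B v - shift ((-1) ^ n) 0 0 (swap (dist n B A v)).
  apply/funext => k'; apply/funext => m'; apply/funext => l'.
  rewrite !fctE /G /commutator /dist /shift /swap /borcherds !add0r.
  by rewrite [D l' (_ - _)]linearB [D l' (_ *: _)]linearZ /= subrACA -scalerBr.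
have GK : kill N G = 0.
  have KA : kill N (dist n A B v) = 0 by apply/dist_killed/K1; rewrite /N; lia.
  have KB : kill N (dist n B A v) = 0 by apply/dist_killed/K2; rewrite /N; lia.
  rewrite GE killB KA {1}/kill shift23 shift13 -/(kill _ _) kill_swap KB.
  apply/funext => k'; apply/funext => m'; apply/funext => l'.
  by rewrite !fctE /shift /swap scaler0 subr0.
have Ga : iter a mul12 G = 0.
  apply/funext => k'; apply/funext => m'; apply/funext => l'.
  have E s k1 m1 l1 : iter s mul12 G k1 m1 l1 =
      commutator (borcherds A B (n + s%:Z) k1 m1) (D l1) v.
    elim: s k1 m1 => [|s IH] k1 m1; first by rewrite addr0.
    rewrite /= /mul12 !IH /commutator.
    have -> : n + s.+1%:Z = n + s%:Z + 1 by lia.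
    rewrite !borcherdsS subrACA; congr (_ - _); exact: esym (linearB (D l1) _ _).
  have K k1 m1 w : borcherds A B (n + a%:Z) k1 m1 w = 0 by apply: K3; rewrite /a; lia.
  by rewrite E /commutator !K (linear0 (D l')) subr0.
pose G1 := iter N mul23 G.
have : iter (a + N) mul23 G1 = 0.
  apply: (@iter_sub_eq0 _ mul12 mul13 mul23) => //.
  - exact: mul12B.
  - exact: mul13B.
  - exact: mul23B.
  - exact: mul12_13.
  - exact: mul23E.
  - rewrite /G1 (iter_iter_comm _ _ _ mul12_23) Ga.
    exact: zmod_morphism0 (iter_zmod_morphism N mul23B).
rewrite /G1 -iterD => G0.
by have := iter_mul23_eval (a + N + N) G 0 m l; rewrite G0 => /esym.
Qed.

End Dong.
End Locality.

(** * Goddard uniqueness and reconstruction of a vertex algebra from fields *)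

Section Translation.
Context {R : realType} {V : lmodType R[i]}.
Variables (Om : V) (T : {linear V -> V}).
Hypothesis TOm : T Om = 0.
Implicit Types (A B : @fld R V).

(** [T, A(z)] = d/dz A(z). *)
Definition covariant A := forall n v,
  commutator T (A n) v = - (n%:~R *: A (n - 1) v).

(** A(z) Om is regular at z = 0. *)
Definition creative A := forall n, 0 <= n -> A n Om = 0.

(** T acts on A(z) B(w) as d/dz + d/dw, which annihilates (z - w)^n; the
    latter fact appears as a telescoping sum. *)
Lemma expansion_translation A B n k m v : covariant A -> covariant B ->
  commutator T (expansion A B n k m) v =
  - (k%:~R *: expansion A B n (k - 1) m v) - m%:~R *: expansion A B n k (m - 1) v.
Proof.
move=> TA TB.
have [J1 P1] := fld_bound B v (m - 1).
have [J2 P2] := expansion_bound A B m (T v).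
pose J := (J1 + J2)%N.
pose a j := A (n + k - 1 - j%:Z) (B (m + j%:Z) v).
pose b j := A (n + k - j%:Z) (B (m - 1 + j%:Z) v).
have ba j : b j.+1 = a j.
  rewrite /a /b; have -> : n + k - j.+1%:Z = n + k - 1 - j%:Z by lia.
  by have -> : m - 1 + j.+1%:Z = m + j%:Z by lia.
have Z : \sum_(j < J) (a j *~ ((n - j%:Z) * sbin n j) + b j *~ (j%:Z * sbin n j)) = 0.
  (* By absorption the summand is c j - c j.+1. *)
  pose c j := b j *~ (j%:Z * sbin n j).
  have tel J' : \sum_(j < J') (a j *~ ((n - j%:Z) * sbin n j) + b j *~ (j%:Z * sbin n j))
     = c 0%N - c J'.
    elim: J' => [|J' IH]; first by rewrite big_ord0 subrr.
    rewrite big_ord_recr IH /= -/(c J') -addrA; congr (_ + _).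
    rewrite addrC addrK.
    rewrite /c ba -mulrNz; congr (_ *~ _).
    by rewrite (mulrC J'.+1%:Z) sbin_absorb; ring.
  rewrite tel /c mul0r mulr0z sub0r /b P1 ?linear0 ?mul0rz ?oppr0 //.
  by rewrite /J; lia.
have Bm j : (J <= j)%N -> B (m + j%:Z) v = 0.
  move=> Jj; rewrite -(P1 j.+1); last by move: Jj; rewrite /J; lia.
  by congr (B _ v); lia.
have Bm1 j : (J <= j)%N -> B (m - 1 + j%:Z) v = 0.
  by move=> Jj; apply: P1; move: Jj; rewrite /J; lia.
rewrite /commutator !(@expansionE _ _ _ _ _ _ m v J) // (expansionE _ _ _ Bm1).
rewrite (P2 J) ?leq_addl // linear_sum -sumrB.
rewrite !scaler_int !mulrz_suml -[RHS]subr0 -[X in _ = _ - X]Z -!sumrN -!big_split /=.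
apply: eq_bigr => j _; rewrite raddfMz -mulrzBl.
have -> : T (A (n + k - j%:Z) (B (m + j%:Z) v)) - A (n + k - j%:Z) (B (m + j%:Z) (T v))
    = - (a j *~ (n + k - j%:Z)) - b j *~ (m + j%:Z).
  have := TA (n + k - j%:Z) (B (m + j%:Z) v).
  have := congr1 (A (n + k - j%:Z)) (TB (m + j%:Z) v).
  rewrite /commutator (linearB (A _)) (linearN (A _)) (linearZ_LR (A _)) /= !scaler_int.
  have -> : m + j%:Z - 1 = m - 1 + j%:Z by lia.
  have -> : n + k - j%:Z - 1 = n + k - 1 - j%:Z by lia.
  by rewrite -/(a j) -/(b j) => <- <-; rewrite addrA subrK.
rewrite mulrzDl !mulNrz -!mulrzA.
have -> : (n + k - j%:Z) * sbin n j = sbin n j * k + (n - j%:Z) * sbin n j by ring.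
have -> : (m + j%:Z) * sbin n j = sbin n j * m + j%:Z * sbin n j by ring.
rewrite !mulrzDr !opprD.
by rewrite /a /b (addrA n) addrACA; congr (_ + _).
Qed.

Lemma nprod_covariant A B n : covariant A -> covariant B -> covariant (nprod A n B).
Proof.
move=> TA TB m v; rewrite /commutator !nprodE /borcherds.
have := expansion_translation n 0 m v TA TB.
have := expansion_translation n m 0 v TB TA.
rewrite /commutator !mulr0z !scale0r !oppr0 add0r addr0 => E1 E2.
rewrite (linearB T) (linearZ_LR T) /= subrACA -scalerBr E1 E2 scalerN opprK.
by rewrite scalerBr !scalerA mulrC opprB addrC.
Qed.

Lemma nprod_vac A B n : creative A -> creative B ->
  creative (nprod A n B) /\ nprod A n B (-1) Om = A n (B (-1) Om).
Proof.
move=> cA cB; split=> [m m0|]; rewrite nprodE /borcherds.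
  rewrite (@expansionE _ _ _ _ _ _ _ _ 0); last by move=> j _; apply: cB; lia.
  rewrite (@expansionE _ _ _ _ _ _ _ _ 0); last by move=> j _; apply: cA; lia.
  by rewrite !big_ord0 scaler0 subr0.
rewrite (@expansionE _ _ _ _ _ _ _ _ 1); last by move=> j j1; apply: cB; lia.
rewrite (@expansionE _ _ _ _ _ _ _ _ 0); last by move=> j _; apply: cA; lia.
rewrite big_ord0 scaler0 subr0 big_ord1 sbin0 mulr1z /=.
have -> : n + 0 - 0%N%:Z = n by lia.
by have -> : -1 + 0%N%:Z = -1 by lia.
Qed.

(** A(z) Om = exp(z T) A_(-1) Om. *)
Lemma covariant_vac0 A : covariant A -> creative A -> A (-1) Om = 0 ->
  forall n, A n Om = 0.
Proof.
move=> TA cA A0.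
have AN t : A (- 1 - t%:Z) Om = 0.
  elim: t => [|t IH]; first by rewrite subr0.
  have := TA (- 1 - t%:Z) Om.
  rewrite /commutator TOm IH (linear0 T) (linear0 (A _)) subr0 => /esym/eqP.
  rewrite oppr_eq0 scaler_eq0 intr_eq0 => /orP[/eqP|/eqP <-]; first by lia.
  by congr (A _ Om); lia.
case=> n; first exact: cA.
by rewrite -(AN n) NegzE; congr (A _ Om); lia.
Qed.

End Translation.

Section Combinations.
Context {R : realType} {V : lmodType R[i]}.
Implicit Types (A B D : @fld R V).

Lemma fld_comb_is_field (a : R[i]) (A B : @fld R V) :
  is_field (fun n v => a *: A n v + B n v).
Proof.
move=> v; have [M MP] := fldP A v; have [N NP] := fldP B v.
exists (`|M| + `|N|) => n nP; rewrite MP ?NP ?scaler0 ?addr0 //; lia.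
Qed.

Lemma fld_comb_linear (a : R[i]) (A B : @fld R V) n :
  linear (fun v => a *: A n v + B n v).
Proof.
move=> b u v; rewrite (linearP (A n)) (linearP (B n)) !scalerDr !scalerA (mulrC a).
rewrite -!addrA; congr (_ + _).
by rewrite addrCA.
Qed.

Definition fld_comb a A B : fld :=
  mkfld (fld_comb_linear a A B) (fld_comb_is_field a A B).

Lemma flocal_comb a A B D : flocal D A -> flocal D B -> flocal D (fld_comb a A B).
Proof.
move=> [M MP] [N NP]; exists (M + N)%N => v m n.
have E p q : commutator (D p) (fld_comb a A B q) v =
    a *: commutator (D p) (A q) v + commutator (D p) (B q) v.
  by rewrite /commutator /= (linearP (D p)) scalerBr opprD addrACA.
rewrite (iter_mul_zw_ext _ E) iter_mul_zwP.
rewrite (iter_mul_zw_leq _ (MP v)) ?leq_addr // (iter_mul_zw_leq _ (NP v)) ?leq_addl //.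
by rewrite scaler0 addr0.
Qed.

Definition vac_mode (n : int) (v : V) : V := (n == -1)%:R *: v.

Lemma vac_is_field : is_field vac_mode.
Proof.
move=> v; exists 0 => n n0; rewrite /vac_mode.
have -> : (n == -1) = false by lia.
by rewrite scale0r.
Qed.

Lemma vac_linear n : linear (vac_mode n).
Proof. by move=> a u v; rewrite /vac_mode scalerDr !scalerA (mulrC _ a). Qed.

Definition vac_fld : @fld R V :=
  @mkfld R V _ vac_linear vac_is_field.

Lemma flocal_vac A : flocal A vac_fld.
Proof.
exists 0%N => v m n /=.
by rewrite /commutator /= /vac_mode (linearZ_LR (A _)) subrr.
Qed.

End Combinations.

Section Reconstruction.
Context {R : realType} {V : lmodType R[i]}.
Variables (Om : V) (T : {linear V -> V}) (I : Type) (g : I -> @fld R V).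
Hypothesis TOm : T Om = 0.
Hypothesis g_local : forall i j, flocal (g i) (g j).
Hypothesis g_cov : forall i, covariant T (g i).
Hypothesis g_creat : forall i, creative Om (g i).
Hypothesis g_cyclic : forall U : V -> Prop, U Om ->
  (forall (a : R[i]) u v, U u -> U v -> U (a *: u + v)) ->
  (forall i n v, U v -> U (g i n v)) -> forall v, U v.

(** The fields that will be the Y(a, z). *)
Record state_field (A : @fld R V) : Prop := {
  sf_cov : covariant T A;
  sf_creat : creative Om A;
  sf_local : forall i, flocal (g i) A }.

(** Goddard's uniqueness theorem.  A kills Om; if it kills v, then locality
    shows that (z - w)^N A(z) g(w) v = 0, and g(w) v is truncated in w. *)
Lemma state_field_eq0 A : state_field A -> A (-1) Om = 0 -> forall n v, A n v = 0.
Proof.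
move=> [TA cA lA] A0 n v; move: v n; apply: g_cyclic.
- exact: covariant_vac0 TA cA A0.
- by move=> a u v u0 v0 n; rewrite linearP u0 v0 scaler0 addr0.
move=> i n v v0 k.
have [N NP] := flocal_sym (lA i).
have [N0 N0P] := fldP (g i) v.
apply: (@iter_mul_zw_eq0 _ _ N (fun p q => A p (g i q v))) => [p q|].
  rewrite -[RHS](NP v p q); apply: iter_mul_zw_ext => p' q'.
  by rewrite /commutator v0 linear0 subr0.
by exists N0 => p q /N0P ->; rewrite linear0.
Qed.

Lemma state_field_comb a A B : state_field A -> state_field B ->
  state_field (fld_comb a A B).
Proof.
move=> [TA cA lA] [TB cB lB]; split.
- move=> n v; have := TA n v; have := TB n v; rewrite /commutator => EB EA.
  rewrite /= (linearP T) opprD addrACA -scalerBr EA EB scalerDr !scalerA.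
  by rewrite scalerN scalerA mulrC opprD.
- by move=> n n0 /=; rewrite cA ?cB ?scaler0 ?addr0.
- by move=> i; apply: flocal_comb.
Qed.

Lemma state_field_inj A B : state_field A -> state_field B ->
  A (-1) Om = B (-1) Om -> forall n v, A n v = B n v.
Proof.
move=> sA sB AB n v.
have := @state_field_eq0 (fld_comb (-1) B A) (state_field_comb (-1) sB sA) _ n v.
by rewrite /= !scaleN1r AB addNr addrC => /(_ erefl)/eqP; rewrite subr_eq0 => /eqP.
Qed.

Lemma state_field_nprod i A n : state_field A -> state_field (nprod (g i) n A).
Proof.
move=> [TA cA lA]; split.
- exact: nprod_covariant.
- by case: (nprod_vac n (g_creat i) cA).
- by move=> j; apply/flocal_sym/dong => //; apply: flocal_sym.
Qed.

Lemma state_field_vac : state_field vac_fld.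
Proof.
split.
- move=> n v; rewrite /commutator /= /vac_mode (linearZ_LR T) subrr.
  case: (eqVneq (n - 1) (-1)) => [|_]; last by rewrite scale0r scaler0 oppr0.
  move=> n1; have -> : n = 0 by lia.
  by rewrite mulr0z scale0r oppr0.
- move=> n n0; rewrite /= /vac_mode.
  have -> : (n == -1) = false by lia.
  by rewrite scale0r.
- by move=> i; apply: flocal_vac.
Qed.

(** The condition of locality with one more field D survives n-th products by
    Dong's lemma; this yields the locality of all pairs Y(a, z), Y(b, z). *)
Lemma state_field_local_surj (D : @fld R V) : state_field D -> forall v,
  exists A, [/\ state_field A, flocal D A & A (-1) Om = v].
Proof.
move=> sD; apply: g_cyclic.
- exists vac_fld; split; [exact: state_field_vac|exact: flocal_vac|].
  by rewrite /= /vac_mode eqxx scale1r.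
- move=> a u v [A [sA lA <-]] [B [sB lB <-]].
  by exists (fld_comb a A B); split; [exact: state_field_comb|exact: flocal_comb|].
move=> i n v [A [sA lA <-]]; exists (nprod (g i) n A); split.
- exact: state_field_nprod.
- exact: flocal_sym (dong (sf_local sA i) (sf_local sD i) (flocal_sym lA) n).
- by case: (nprod_vac n (g_creat i) (sf_creat sA)).
Qed.

Lemma state_field_surj v : exists A, state_field A /\ A (-1) Om = v.
Proof.
have [A [sA _ AE]] := state_field_local_surj state_field_vac v.
by exists A.
Qed.

(** The state-field correspondence is the inverse of the bijection
    A |-> A_(-1) Om from state fields to V. *)
Theorem reconstruction : exists Y : V -> @fld R V,
  [/\ forall v, state_field (Y v), forall v, Y v (-1) Om = v
    & vertex_algebra (fun v n => Y v n) Om T].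
Proof.
have [Y YP] := choice state_field_surj.
have sY v : state_field (Y v) by case: (YP v).
have Y1 v : Y v (-1) Om = v by case: (YP v).
exists Y; split => //; split => //.
- move=> n b a u v.
  by rewrite -[RHS]/(fld_comb a (Y u) (Y v) n b); apply: state_field_inj;
    [|exact: state_field_comb|rewrite /= !Y1].
- by move=> a n; apply: linearP.
- exact: linearP.
- by move=> a; apply: fldP.
- by move=> a; apply: sf_cov.
- move=> n b; rewrite -[RHS]/(vac_fld n b); apply: state_field_inj => //.
  + exact: state_field_vac.
  + by rewrite Y1 /= /vac_mode eqxx scale1r.
- by move=> a n; apply: sf_creat.
- move=> a b; have [A [sA lA AE]] := state_field_local_surj (sY a) b.
  suff -> : (fun n : int => Y b n : V -> V) = (fun n => A n) by [].
  apply/funext => n; apply/funext => v; apply: state_field_inj => //.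
  by rewrite AE Y1.
Qed.

End Reconstruction.

(** * Locality of the fields of the W3-algebra *)

Section PolynomialLocality.
Context {R : realType} {V : lmodType R[i]}.
Implicit Types (D : V -> int -> int -> V).

(** Uniform form of the locality condition, for families indexed by vectors. *)
Definition killed N D := forall v m n, iter N mul_zw (D v) m n = 0.

Lemma killedS N D : killed N.+1 D -> killed N (fun v => mul_zw (D v)).
Proof. by move=> D0 v m n; rewrite -iterSr. Qed.

(** Leibniz rule: a factor p costs one more power of z - w. *)
Lemma killed_mulp N D : killed N D -> killed N.+1 (fun v p q => p%:~R *: D v p q).
Proof.
elim: N D => [|N IH] D D0 v m n.
  by have D00 := D0 v : forall p q, D v p q = 0; rewrite /= /mul_zw !D00 !scaler0 subr0.
rewrite iterSr.
have E p q : mul_zw (fun p q => p%:~R *: D v p q) p q =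
    1 *: (p%:~R *: mul_zw (D v) p q) + D v (p + 1) (q + 0).
  rewrite /mul_zw scale1r addr0 scalerBr addrAC intrD scalerDl scale1r.
  by congr (_ - _).
rewrite (iter_mul_zw_ext _ E) iter_mul_zwP.
rewrite (IH (fun v => mul_zw (D v)) (killedS D0) v) scaler0 add0r.
by rewrite (iter_mul_zw_shift N.+1 (D v)) D0.
Qed.

Lemma killed_mulq N D : killed N D -> killed N.+1 (fun v p q => q%:~R *: D v p q).
Proof.
elim: N D => [|N IH] D D0 v m n.
  by have D00 := D0 v : forall p q, D v p q = 0; rewrite /= /mul_zw !D00 !scaler0 subr0.
rewrite iterSr.
have E p q : mul_zw (fun p q => q%:~R *: D v p q) p q =
    (-1) *: D v (p + 0) (q + 1) + q%:~R *: mul_zw (D v) p q.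
  rewrite /mul_zw addr0 scalerBr scaleN1r intrD scalerDl scale1r opprD.
  by rewrite addrA addrC.
rewrite (iter_mul_zw_ext _ E) iter_mul_zwP.
rewrite (IH (fun v => mul_zw (D v)) (killedS D0) v) addr0.
by rewrite (iter_mul_zw_shift N.+1 (D v)) D0 scaler0.
Qed.

Inductive polyfun : (int -> int -> int) -> Prop :=
| polyfun_fst : polyfun (fun p q => p)
| polyfun_snd : polyfun (fun p q => q)
| polyfun_const z : polyfun (fun p q => z)
| polyfun_opp g : polyfun g -> polyfun (fun p q => - g p q)
| polyfun_add g g' : polyfun g -> polyfun g' -> polyfun (fun p q => g p q + g' p q)
| polyfun_mul g g' : polyfun g -> polyfun g' -> polyfun (fun p q => g p q * g' p q).

Lemma killed_lin N M a D E : killed N D -> killed M E ->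
  killed (N + M) (fun v p q => a *: D v p q + E v p q).
Proof.
move=> D0 E0 v m n; rewrite iter_mul_zwP.
rewrite (iter_mul_zw_leq _ (D0 v)) ?leq_addr // scaler0 add0r.
by rewrite (iter_mul_zw_leq _ (E0 v)) ?leq_addl.
Qed.

Lemma killed_ext N D E : (forall v p q, D v p q = E v p q) -> killed N E -> killed N D.
Proof. by move=> DE E0 v m n; rewrite (iter_mul_zw_ext _ (DE v)) E0. Qed.

Lemma killed_scale N a D : killed N D -> killed N (fun v p q => a *: D v p q).
Proof.
move=> D0; have Z0 : killed 0 (fun (v : V) (p q : int) => 0 : V) by [].
rewrite -[N]addn0; apply: (killed_ext _ (killed_lin a D0 Z0)) => v p q.
by rewrite addr0.
Qed.

Lemma killed_poly g : polyfun g -> forall N D, killed N D ->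
  exists M, killed M (fun v p q => (g p q)%:~R *: D v p q).
Proof.
elim=> [||z|{}g _ IHg|{}g g' _ IHg _ IHg'|{}g g' _ IHg _ IHg'] N D D0.
- by exists N.+1; apply: killed_mulp.
- by exists N.+1; apply: killed_mulq.
- by exists N; apply: killed_scale.
- have [M H] := IHg _ _ D0; exists M.
  apply: (killed_ext _ (killed_scale (-1) H)) => v p q.
  by rewrite intrN scalerA mulN1r.
- have [M H] := IHg _ _ D0; have [M' H'] := IHg' _ _ D0; exists (M + M')%N.
  apply: (killed_ext _ (killed_lin 1 H H')) => v p q.
  by rewrite scale1r -scalerDl -intrD.
- have [M' H'] := IHg' _ _ D0; have [M H] := IHg _ _ H'; exists M.
  by apply: (killed_ext _ H) => v p q; rewrite scalerA -intrM.
Qed.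

(** A coefficient that depends on p + q only is killed by z - w. *)
Lemma killed_antidiag g (X : int -> V -> V) : polyfun g ->
  exists M, killed M (fun v p q => (g p q)%:~R *: X (p + q) v).
Proof.
move=> pg; apply: (killed_poly pg (N := 1) (D := fun v p q => X (p + q) v)).
by move=> v m n; rewrite /= /mul_zw addrAC addrA subrr.
Qed.

End PolynomialLocality.

Section W3Fields.
Context {R : realType} {V : lmodType R[i]}.
Variables (c h w : R[i]) (L W : int -> {linear V -> V}) (Om : V).
Hypotheses (hrep : W3_representation c L W) (hlow : lowest_weight_vector L W h w Om).
Hypotheses (hvac : L (- 1) Om = 0).

Lemma Lfield_is_field : is_field (fun n => L (n - 1)).
Proof.
move=> v; have [N NP] := W3_fieldL hrep v.
by exists (N + 1) => n n0; apply: NP; lia.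
Qed.

Lemma Wfield_is_field : is_field (fun n => W (n - 2)).
Proof.
move=> v; have [N NP] := W3_fieldW hrep v.
by exists (N + 2) => n n0; apply: NP; lia.
Qed.

(** The coefficient of z^(-n-1) in the sum of L_n z^(-n-2) is L_(n-1). *)
Definition Lfield : fld := Fld Lfield_is_field.
Definition Wfield : fld := Fld Wfield_is_field.

Lemma killed_local N (A B : @fld R V) :
  killed N (fun v p q => commutator (A p) (B q) v) ->
  flocal A B.
Proof. by exists N. Qed.

Lemma Lfield_local : flocal Lfield Lfield.
Proof.
have p1 : polyfun (fun p q => p - q).
  by apply: polyfun_add; [apply: polyfun_fst|apply/polyfun_opp/polyfun_snd].
have p2 : polyfun (fun p q => (p - 1) * ((p - 1) * (p - 1) - 1)).
  have p3 : polyfun (fun p q => p - 1).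
    by apply: polyfun_add; [apply: polyfun_fst|apply: polyfun_const].
  apply: polyfun_mul => //; apply: polyfun_add; last exact: polyfun_const.
  exact: polyfun_mul.
have [N1 K1] := killed_antidiag (fun s => L (s - 2)) p1.
have [N2 K2] := killed_antidiag (fun s (v : V) => (c / 12%:R * (s - 2 == 0)%:R) *: v) p2.
apply: (@killed_local (N1 + N2)); apply: (killed_ext _ (killed_lin 1 K1 K2)) => v p q.
rewrite [LHS](W3_LL hrep) scale1r; congr (_ *: _ + _).
- by congr (_ %:~R); lia.
- by congr (L _ v); lia.
- rewrite scalerA; congr (_ *: _).
  by rewrite mulrA (mulrC _ (c / _)) expr2; congr (_ * _ * (_ == _)%:R); lia.
Qed.

Lemma LWfield_local : flocal Lfield Wfield.
Proof.
have p1 : polyfun (fun p q => p + p - q).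
  apply: polyfun_add; last by apply/polyfun_opp/polyfun_snd.
  by apply: polyfun_add; apply: polyfun_fst.
have [N1 K1] := killed_antidiag (fun s => W (s - 3)) p1.
apply: (@killed_local N1); apply: (killed_ext _ K1) => v p q.
rewrite [LHS](W3_LW hrep); congr (_ *: _).
- by congr (_ %:~R); lia.
- by congr (W _ v); lia.
Qed.

(** The three families of structure constants are polynomials in m = p - 2 and
    n = q - 2 times functions of p + q. *)
Lemma Wfield_local : flocal Wfield Wfield.
Proof.
pose m := fun p q : int => p - 2; pose n := fun p q : int => q - 2.
have pm : polyfun m by apply: polyfun_add; [apply: polyfun_fst|apply: polyfun_const].
have pn : polyfun n by apply: polyfun_add; [apply: polyfun_snd|apply: polyfun_const].
have pD g g' : polyfun g -> polyfun g' -> polyfun (fun p q => g p q - g' p q).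
  by move=> pg pg'; apply: polyfun_add => //; apply: polyfun_opp.
have p1 : polyfun (fun p q => (m p q ^+ 2 - 4) * (m p q ^+ 2 - 1) * m p q).
  apply: polyfun_mul => //; apply: polyfun_mul; apply: pD; try exact: polyfun_const.
  - exact: polyfun_mul.
  - exact: polyfun_mul.
have p2 : polyfun (fun p q => m p q - n p q) by apply: pD.
have p3 : polyfun (fun p q => (m p q - n p q) *
    (2 * m p q ^+ 2 - m p q * n p q + 2 * n p q ^+ 2 - 8)).
  have p2z g : polyfun g -> polyfun (fun p q => 2 * g p q).
    by move=> pg; apply: polyfun_mul => //; apply: polyfun_const.
  apply: polyfun_mul => //; apply: (pD _ (fun=> fun=> 8)); last exact: polyfun_const.
  apply: polyfun_add; last by apply: p2z; apply: polyfun_mul.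
  by apply: (pD (fun p q => 2 * m p q ^+ 2)); [apply: p2z|]; apply: polyfun_mul.
have [N1 K1] := killed_antidiag
  (fun s (v : V) => (c / (3 * 5`!)%:R * (s - 4 == 0)%:R) *: v) p1.
have [N2 K2] := killed_antidiag (fun s => Lambda L (s - 4)) p2.
have [N3 K3] := killed_antidiag (fun s => L (s - 4)) p3.
apply: (@killed_local (N3 + (N2 + N1))).
apply: (killed_ext _ (killed_lin 30%:R^-1 K3 (killed_lin (bsq c) K2 K1))) => v p q.
rewrite [LHS](W3_WW hrep) addrC !scalerA.
have -> : p - 2 + (q - 2) = p + q - 4 by lia.
congr (_ *: _ + _); rewrite addrC; congr (_ + _ *: _).
by rewrite mulrAC [RHS]mulrC.
Qed.

Lemma Lfield_cov : covariant (L (-1)) Lfield.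
Proof.
move=> n v; rewrite [LHS](W3_LL hrep) /=.
have -> : -1 + (n - 1) = n - 1 - 1 by lia.
have -> : (-1 : int) * ((-1) ^+ 2 - 1) = 0 by [].
by rewrite mulr0z mulr0 mul0r scale0r addr0 -scaleNr -intrN; congr (_%:~R *: _); lia.
Qed.

Lemma Wfield_cov : covariant (L (-1)) Wfield.
Proof.
move=> n v; rewrite [LHS](W3_LW hrep) /=.
have -> : -1 + (n - 2) = n - 1 - 2 by lia.
by rewrite -scaleNr -intrN; congr (_%:~R *: _); lia.
Qed.

(** Applying [L_1, L_-1] = 2 L_0 to Om shows that the lowest weight h is 0. *)
Lemma Lfield_creative : creative Om Lfield.
Proof.
move=> n n0 /=.
have := W3_LL hrep 1 (-1) Om.
rewrite /commutator hvac (lwv_L_gt0 hlow) // !(linear0 (L _)) subr0.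
have -> : (1 : int) * (1 ^+ 2 - 1) = 0 by [].
rewrite mulr0z mulr0 mul0r scale0r addr0 => /esym/eqP.
rewrite scaler_eq0 intr_eq0 /= => /eqP L0.
have [->|n1] := eqVneq n 0; first by rewrite sub0r.
have [->|n2] := eqVneq n 1; first by rewrite subrr.
by apply: (lwv_L_gt0 hlow); lia.
Qed.

(** Commuting successively with L_-1 shows that W_0, W_-1 and W_-2 kill Om;
    in particular w = 0. *)
Lemma Wfield_creative : creative Om Wfield.
Proof.
move=> n n0 /=.
have step m : W m Om = 0 -> -2 - m != 0 -> W (m - 1) Om = 0.
  move=> Wm m0; have := W3_LW hrep (-1) m Om.
  rewrite /commutator hvac Wm (linear0 (L _)) (linear0 (W _)) subr0 => /esym/eqP.
  rewrite scaler_eq0 intr_eq0 => /orP[/eqP E|/eqP <-]; first by lia.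
  by congr (W _ Om); lia.
have W1 : W 1 Om = 0 by apply: (lwv_W_gt0 hlow).
have W0 : W 0 Om = 0 by rewrite -(step 1 W1).
have Wm1 : W (-1) Om = 0 by rewrite -(step 0 W0).
have Wm2 : W (-2) Om = 0 by rewrite -(step (-1) Wm1).
have [->|n1] := eqVneq n 0; first by rewrite sub0r.
have [->|n2] := eqVneq n 1; first by [].
have [->|n3] := eqVneq n 2; first by rewrite subrr.
by apply: (lwv_W_gt0 hlow); lia.
Qed.

Definition W3_field (b : bool) : fld := if b then Lfield else Wfield.

End W3Fields.

(** * Straightening of words in the modes *)

Section LinearSpan.
Context {R : realType} {V : lmodType R[i]}.
Implicit Types (P Q U : V -> Prop).

(** Prop-valued counterpart of [submod_closed]. *)
Record subspace U : Prop := {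
  subspace0 : U 0;
  subspaceP : forall (a : R[i]) u v, U u -> U v -> U (a *: u + v) }.

Lemma subspaceZ U a u : subspace U -> U u -> U (a *: u).
Proof. by move=> sU Uu; rewrite -[_ *: _]addr0; apply: subspaceP => //; apply: subspace0. Qed.

Lemma subspaceD U u v : subspace U -> U u -> U v -> U (u + v).
Proof. by move=> sU Uu Uv; rewrite -[u]scale1r; apply: subspaceP. Qed.

Lemma subspaceN U u : subspace U -> U u -> U (- u).
Proof. by move=> sU Uu; rewrite -scaleN1r; apply: subspaceZ. Qed.

Lemma subspace_sum U (I : Type) (r : seq I) (F : I -> V) :
  subspace U -> (forall i, U (F i)) -> U (\sum_(i <- r) F i).
Proof.
move=> sU UF; elim/big_ind: _ => //; first exact: subspace0.
by move=> u v; apply: subspaceD.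
Qed.

Inductive lin_span P : V -> Prop :=
| lin_span0 : lin_span P 0
| lin_spanS a u v : P u -> lin_span P v -> lin_span P (a *: u + v).

Lemma lin_span_subspace P : subspace (lin_span P).
Proof.
split=> [|a u v Pu Pv]; first exact: lin_span0.
elim: Pu => [|b u' v' Pu' _ IH]; first by rewrite scaler0 add0r.
by rewrite scalerDr scalerA -addrA; apply: lin_spanS.
Qed.

Lemma lin_span_mem (P : V -> Prop) u : P u -> lin_span P u.
Proof. by move=> Pu; rewrite -[u]addr0 -[u]scale1r; apply: lin_spanS => //; apply: lin_span0. Qed.

Lemma lin_span_min P U : subspace U -> (forall u, P u -> U u) ->
  forall v, lin_span P v -> U v.
Proof.
move=> sU PU v; elim=> [|a u v' Pu _ Uv']; first exact: subspace0.
by apply: subspaceP => //; apply: PU.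
Qed.

Lemma subspace_preim U (f : {linear V -> V}) : subspace U -> subspace (fun v => U (f v)).
Proof.
move=> sU; split=> [|a u v Uu Uv]; first by rewrite linear0; apply: subspace0.
by rewrite linearP; apply: subspaceP.
Qed.

Lemma lin_span_map P Q (f : {linear V -> V}) : (forall u, P u -> lin_span Q (f u)) ->
  forall v, lin_span P v -> lin_span Q (f v).
Proof. by move=> PQ; apply: lin_span_min => //; apply/subspace_preim/lin_span_subspace. Qed.

Lemma lin_span_sub P Q : (forall u, P u -> Q u) -> forall v, lin_span P v -> lin_span Q v.
Proof.
by move=> PQ; apply: lin_span_min => [|u /PQ/lin_span_mem //]; apply: lin_span_subspace.
Qed.

Lemma lin_span_seq P (s : seq V) : (forall u, P u -> u \in s) ->
  forall v, lin_span P v -> exists a : 'I_(size s) -> R[i], v = \sum_i a i *: s`_i.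
Proof.
move=> Ps v; elim=> [|a u v' /Ps us _ [b ->]].
  by exists (fun=> 0); rewrite big1 // => i _; rewrite scale0r.
have iu : (index u s < size s)%N by rewrite index_mem.
exists (fun i => (i == Ordinal iu)%:R * a + b i).
rewrite [RHS](eq_bigr (fun i => ((i == Ordinal iu)%:R * a) *: s`_i + b i *: s`_i)); last first.
  by move=> i _; rewrite scalerDl.
rewrite big_split; congr (_ + _).
rewrite (bigD1 (Ordinal iu)) // eqxx mul1r big1 => [|i /negPf ->].
  by rewrite /= addr0 nth_index.
by rewrite mul0r scale0r.
Qed.

End LinearSpan.

Section Straightening.
Context {R : realType} {V : lmodType R[i]}.
Variables (L W : int -> {linear V -> V}) (Om : V).

Hypothesis LL : forall m n v (U : V -> Prop), subspace U ->
  U v -> U (L (m + n) v) -> U (commutator (L m) (L n) v).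
Hypothesis LW : forall m n v (U : V -> Prop), subspace U ->
  U (W (m + n) v) -> U (commutator (L m) (W n) v).
Hypothesis WW : forall m n v (U : V -> Prop), subspace U ->
  U v -> (forall k, U (L k v)) -> (forall k l, U (L k (L l v))) ->
  U (commutator (W m) (W n) v).
Hypothesis L_vac : forall n, 0 <= n -> L n Om = 0.
Hypothesis W_vac : forall n, 0 <= n -> W n Om = 0.

(** In [negword d p v] the vector v is a word of negative modes applied to Om,
    of weight p and of degree d, where L has degree 1 and W has degree 2. *)
Inductive negword : nat -> nat -> V -> Prop :=
| negword_vac : negword 0 0 Om
| negword_L a d p v : negword d p v -> negword d.+1 (a.+1 + p) (L (- a.+1%:Z) v)
| negword_W a d p v : negword d p v -> negword d.+2 (a.+1 + p) (W (- a.+1%:Z) v).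

Definition negspan d := lin_span (fun v => exists d' p, (d' <= d)%N /\ negword d' p v).

Let sN d : subspace (negspan d) := lin_span_subspace _.

Lemma negspan_leq d d' v : (d <= d')%N -> negspan d v -> negspan d' v.
Proof.
move=> dd'; apply: lin_span_sub => u [e [p [ed wu]]].
by exists e, p; split=> //; apply: leq_trans dd'.
Qed.

Lemma negspan_word d p v : negword d p v -> negspan d v.
Proof. by move=> wv; apply: lin_span_mem; exists d, p. Qed.

Lemma negspan_L d n v : n < 0 -> negspan d v -> negspan d.+1 (L n v).
Proof.
case: n => // a _; rewrite NegzE; apply: lin_span_map => u [e [p [ed wu]]].
by apply: lin_span_mem; exists e.+1, (a.+1 + p)%N; split=> //; apply: negword_L.
Qed.

Lemma negspan_W d n v : n < 0 -> negspan d v -> negspan d.+2 (W n v).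
Proof.
case: n => // a _; rewrite NegzE; apply: lin_span_map => u [e [p [ed wu]]].
by apply: lin_span_mem; exists e.+2, (a.+1 + p)%N; split=> //; apply: negword_W.
Qed.

Lemma swapE (f g : {linear V -> V}) v : f (g v) = g (f v) + commutator f g v.
Proof. by rewrite /commutator addrC subrK. Qed.

(** Induction on the degree.  A nonnegative mode is moved to the right until it
    kills Om; each commutator on the way is a combination of words of smaller
    degree, since [L, L] has degree 1 < 2, [L, W] has degree 2 < 3 and [W, W]
    has degree 2 < 4. *)
Lemma straighten D :
  (forall d n v, (d.+1 <= D)%N -> negspan d v -> negspan d.+1 (L n v)) /\
  (forall d n v, (d.+2 <= D)%N -> negspan d v -> negspan d.+2 (W n v)).
Proof.
elim: D => [|D [IHL IHW]]; first by [].
have wordL d p n v : (d.+1 <= D.+1)%N -> negword d p v -> negspan d.+1 (L n v).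
  move=> dD wv; have [n0|n0] := ltP n 0; first exact: negspan_L (negspan_word wv).
  case: wv dD => [_|a {}d {}p u wu dD|a {}d {}p u wu dD].
  - by rewrite L_vac //; apply: subspace0.
  - have nu := negspan_word wu.
    have Lu k : negspan d.+1 (L k u) by apply: IHL.
    rewrite swapE; apply: subspaceD => //; first by apply: negspan_L.
    apply: (LL (U := negspan d.+2)) => //; last exact: negspan_leq (Lu _).
    by apply: negspan_leq nu; lia.
  - have nu := negspan_word wu.
    rewrite swapE; apply: subspaceD => //.
      by apply: negspan_W => //; apply: IHL => //; lia.
    apply: LW => //; apply: (@negspan_leq d.+2); first lia.
    by apply: IHW => //; lia.
have wordW d p n v : (d.+2 <= D.+1)%N -> negword d p v -> negspan d.+2 (W n v).
  move=> dD wv; have [n0|n0] := ltP n 0; first exact: negspan_W (negspan_word wv).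
  case: wv dD => [_|a {}d {}p u wu dD|a {}d {}p u wu dD].
  - by rewrite W_vac //; apply: subspace0.
  - have nu := negspan_word wu.
    have Wu k : negspan d.+2 (W k u) by apply: IHW.
    rewrite swapE; apply: subspaceD => //; first by apply: negspan_L.
    have -> : commutator (W n) (L (- a.+1%:Z)) u = - commutator (L (- a.+1%:Z)) (W n) u.
      by rewrite /commutator opprB.
    apply: subspaceN => //; apply: LW => //.
    by apply: (@negspan_leq d.+2).
  - have nu := negspan_word wu.
    rewrite swapE; apply: subspaceD => //.
      by apply: negspan_W => //; apply: IHW => //; lia.
    have Lu k : negspan d.+1 (L k u) by apply: IHL => //; lia.
    apply: WW => //.
    + by apply: negspan_leq nu; lia.
    + by move=> k; apply: negspan_leq (Lu k); lia.
    + move=> k l; apply: (@negspan_leq d.+2); first lia.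
      by apply: IHL => //; lia.
split=> d n v dD; apply: lin_span_map => u [e [p [ed wu]]].
- apply: (@negspan_leq e.+1); first lia.
  by apply: wordL wu; lia.
- apply: (@negspan_leq e.+2); first lia.
  by apply: wordW wu; lia.
Qed.

Definition word p v := exists d, negword d p v.

Theorem word_span (U : V -> Prop) : subspace U -> (forall p v, word p v -> U v) ->
  forall v, (forall U' : V -> Prop, subspace U' -> U' Om -> (forall n v, U' v -> U' (L n v)) ->
    (forall n v, U' v -> U' (W n v)) -> U' v) -> U v.
Proof.
move=> sU wU v cv.
suff [d] : exists d, negspan d v.
  by apply: lin_span_min => // u [d' [p [_ wu]]]; apply: (wU p); exists d'.
apply: (cv (fun v => exists d, negspan d v)).
- split=> [|a u u' [d du] [d' du']]; first by exists 0%N; apply: subspace0.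
  exists (d + d')%N; apply: subspaceP => //.
  + by apply: negspan_leq du; lia.
  + by apply: negspan_leq du'; lia.
- by exists 0%N; apply: negspan_word negword_vac.
- by move=> n u [d du]; exists d.+1; have [H _] := straighten d.+1; apply: H.
- by move=> n u [d du]; exists d.+2; have [_ H] := straighten d.+2; apply: H.
Qed.

(** Every letter has positive weight, so a word of weight n arises by one letter
    from a word of smaller weight. *)
Lemma word_finite n : exists s : seq V, forall p v, (p < n)%N -> word p v -> v \in s.
Proof.
elim: n => [|n [s sP]]; first by exists [::].
pose s' := flatten [seq [:: L (- a%:Z) v; W (- a%:Z) v] | a <- iota 0 n.+1, v <- s].
exists (Om :: s') => p v pn [d wv]; rewrite inE.
have mem a u x : (a < n)%N -> u \in s ->
    x \in [:: L (- a.+1%:Z) u; W (- a.+1%:Z) u] -> x \in s'.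
  move=> an us ux; apply/flattenP; exists [:: L (- a.+1%:Z) u; W (- a.+1%:Z) u] => //.
  by apply/allpairsP; exists (a.+1, u); rewrite mem_iota.
case: wv pn => [_|a {}d q u wu pn|a {}d q u wu pn]; first by rewrite eqxx.
- apply/orP; right; apply: (mem a u); rewrite ?inE ?eqxx //; first lia.
  by apply: (sP q); [lia|exists d].
- apply/orP; right; apply: (mem a u); rewrite ?inE ?eqxx ?orbT //; first lia.
  by apply: (sP q); [lia|exists d].
Qed.

End Straightening.

(** * The conformal grading of a lowest weight representation *)

Section LambdaSum.
Context {R : realType} {V : lmodType R[i]}.
Variable L : int -> {linear V -> V}.
Hypothesis fieldL : is_field (fun n => L n).

(** The terms k = j - 1 of the first sum and k = -2 - j of the second sum in
    the definition of Lambda. *)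
Definition Lambda_term (n : int) (j : nat) (v : V) : V :=
  L (n - (j%:Z - 1)) (L (j%:Z - 1) v) + L (- 2 - j%:Z) (L (n + 2 + j%:Z) v).

Lemma Lambda_bound n v : exists J0, forall J, (J0 <= J)%N ->
  Lambda L n v = \sum_(j < J) Lambda_term n j v
    - (3%:R / 10%:R * ((n + 2) * (n + 3))%:~R) *: L n v.
Proof.
have [N NP] := fieldL v.
exists (`|N| + `|n| + 3)%N => J JJ0; rewrite /Lambda big_split /=.
congr (_ + _ - _).
- rewrite (reindex_fsbig (fun j : nat => j%:Z - 1) [set: nat]%classic); last first.
    split=> [j _ /=|i j _ _ /= ij|k /= k2]; [lia|lia|].
    by exists (absz (k + 1)) => //; lia.
  by apply: fsum_ord => j Jj; rewrite (NP (j%:Z - 1)) ?linear0 //; lia.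
- rewrite (reindex_fsbig (fun j : nat => -2 - j%:Z) [set: nat]%classic); last first.
    split=> [j _ /=|i j _ _ /= ij|k /= k2]; [lia|lia|].
    by exists (absz (k + 2)) => //; lia.
  rewrite (@fsum_ord _ _ J) => [|j Jj].
    apply: eq_bigr => j _; congr (L _ (L _ v)); lia.
  by rewrite (NP (n - (-2 - j%:Z))) ?linear0 //; lia.
Qed.

(** On each vector Lambda is a finite combination of quadratic words. *)
Lemma Lambda_subspace n v (U : V -> Prop) : subspace U ->
  (forall k, U (L k v)) -> (forall k l, U (L k (L l v))) -> U (Lambda L n v).
Proof.
move=> sU Uk Ukl; have [J JP] := Lambda_bound n v; rewrite (JP J) //.
apply: subspaceD => //; last by apply: subspaceN => //; apply: subspaceZ.
by apply: subspace_sum => // j; apply: subspaceD.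
Qed.

End LambdaSum.

Section W3Grading.
Context {R : realType} {V : lmodType R[i]}.
Variables (c h w : R[i]) (L W : int -> {linear V -> V}) (Om : V).
Hypotheses (hrep : W3_representation c L W) (hlow : lowest_weight_vector L W h w Om).
Hypotheses (hcyc : cyclic_vector L W Om) (hvac : L (- 1) Om = 0).

Lemma L_vac n : -1 <= n -> L n Om = 0.
Proof.
move=> n1; rewrite -[n](addrK 1).
by apply: (Lfield_creative hrep hlow hvac); lia.
Qed.

Lemma W_vac n : -2 <= n -> W n Om = 0.
Proof.
move=> n1; rewrite -[n](addrK 2).
by apply: (Wfield_creative hrep hlow hvac); lia.
Qed.

Lemma cyclic_ind (U : V -> Prop) : subspace U -> U Om ->
  (forall n v, U v -> U (L n v)) -> (forall n v, U v -> U (W n v)) -> forall v, U v.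
Proof.
move=> sU UOm UL UW v; apply/asboolP.
apply: (hcyc (U := fun v => `[< U v >])).
- split=> [|a u u' /asboolP Hu /asboolP Hu']; apply/asboolP.
    exact: subspace0.
  exact: subspaceP.
- exact/asboolP.
- by move=> n u /asboolP Hu; apply/asboolP; apply: UL.
- by move=> n u /asboolP Hu; apply/asboolP; apply: UW.
Qed.

Lemma W3_word_span (U : V -> Prop) : subspace U ->
  (forall p v, word L W Om p v -> U v) -> forall v, U v.
Proof.
move=> sU wU v0; apply: (word_span (L := L) (W := W) (Om := Om) _ _ _ _ _ sU wU).
- move=> m n v U' sU' U'v U'L; rewrite (W3_LL hrep).
  by apply: subspaceP => //; apply: subspaceZ.
- by move=> m n v U' sU' U'W; rewrite (W3_LW hrep); apply: subspaceZ.
- move=> m n v U' sU' U'v U'L U'LL; rewrite (W3_WW hrep).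
  apply: subspaceD => //; last by apply: subspaceZ.
  apply: subspaceP => //; apply: subspaceZ => //.
  by apply: (Lambda_subspace (W3_fieldL hrep)).
- by move=> n n0; apply: L_vac; lia.
- by move=> n n0; apply: W_vac; lia.
- by move=> U' sU' U'Om U'L U'W; apply: cyclic_ind.
Qed.

Definition wt (n : int) (v : V) := L 0 v = n%:~R *: v.

Lemma wt_subspace n : subspace (wt n).
Proof.
split=> [|a u v Hu Hv]; first by rewrite /wt linear0 scaler0.
by rewrite /wt linearP Hu Hv scalerDr !scalerA mulrC.
Qed.

Lemma wt_L m n v : wt n v -> wt (n - m) (L m v).
Proof.
move=> Hv; have := W3_LL hrep 0 m v; rewrite /commutator Hv linearZ /= !mul0r.
rewrite mulr0z mulr0 mul0r scale0r addr0 !add0r => /eqP.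
by rewrite subr_eq -scalerDl -intrD (addrC (- m)) => /eqP.
Qed.

Lemma wt_W m n v : wt n v -> wt (n - m) (W m v).
Proof.
move=> Hv; have := W3_LW hrep 0 m v; rewrite /commutator Hv linearZ /=.
rewrite mulr0 !add0r => /eqP.
by rewrite subr_eq -scalerDl -intrD (addrC (- m)) => /eqP.
Qed.

Lemma wt_vac : wt 0 Om.
Proof. by rewrite /wt L_vac // scale0r. Qed.

Lemma wt_word (p : nat) v : word L W Om p v -> wt p v.
Proof.
case=> d; elim=> [|a {}d {}p u _ IH|a {}d {}p u _ IH]; first exact: wt_vac.
- have -> : (a.+1 + p)%N = p%:Z - (- a.+1%:Z) :> int by lia.
  exact: wt_L.
- have -> : (a.+1 + p)%N = p%:Z - (- a.+1%:Z) :> int by lia.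
  exact: wt_W.
Qed.

(** Words of different weights are collected separately. *)
Lemma graded_sum v : exists f : nat -> V, exists N,
  (forall p, lin_span (word L W Om p) (f p)) /\ v = \sum_(p < N) f p.
Proof.
suff [f [N [fP _ fE]]] : exists f : nat -> V, exists N,
  [/\ forall p, lin_span (word L W Om p) (f p), forall p, (N <= p)%N -> f p = 0
    & v = \sum_(p < N) f p] by exists f, N.
have pad (f : nat -> V) N N' : (forall p, (N <= p)%N -> f p = 0) -> (N <= N')%N ->
    \sum_(p < N) f p = \sum_(p < N') f p.
  move=> f0 /subnKC <-; rewrite big_split_ord /= [X in _ = _ + X]big1 ?addr0 // => p _.
  by rewrite f0 // leq_addr.
move: v; apply: W3_word_span.
- split=> [|a u v [f [N [fP f0 ->]]] [g [M [gP g0 ->]]]].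
    exists (fun=> 0), 0%N; split=> //; last by rewrite big_ord0.
    by move=> p; apply: lin_span0.
  exists (fun p => a *: f p + g p), (N + M)%N; split.
  + by move=> p; apply: subspaceP => //; apply: lin_span_subspace.
  + by move=> p Np; rewrite f0 ?g0 ?scaler0 ?addr0 //; lia.
  + rewrite (pad f N (N + M)%N) ?leq_addr // (pad g M (N + M)%N) ?leq_addl //.
    by rewrite scaler_sumr -big_split.
- move=> p v wv; exists (fun q => if q == p then v else 0), p.+1; split.
  + move=> q; case: eqP => [->|_]; last exact: lin_span0.
    exact: lin_span_mem.
  + by move=> q pq; rewrite gtn_eqF.
  + rewrite big_ord_recr /= eqxx big1 ?add0r // => q _.
    by rewrite ltn_eqF.
Qed.

(** Applying L_0 - N eliminates the component of weight N. *)
Lemma wt_indep N (f : nat -> V) : (forall p : nat, wt p (f p)) -> \sum_(p < N) f p = 0 ->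
  forall p, (p < N)%N -> f p = 0.
Proof.
elim: N f => // N IH f fw f0.
have {}IH (p : nat) : (p < N)%N -> f p = 0.
  move=> pN; have := IH (fun p => (p%:Z - N%:Z)%:~R *: f p) _ _ p pN.
  move=> H; suff /eqP : (p%:Z - N%:Z)%:~R *: f p = 0.
    by rewrite scaler_eq0 intr_eq0 => /orP[/eqP|/eqP //]; lia.
  apply: H => [q|]; first by apply: (subspaceZ _ (wt_subspace q)).
  have := congr1 (fun v => L 0 v - N%:R *: v) f0.
  rewrite linear0 scaler0 subr0 linear_sum scaler_sumr -sumrB big_ord_recr /=.
  rewrite (fw N) pmulrn subrr addr0 => E.
  rewrite -[RHS]E; apply: eq_bigr => q _.
  by rewrite fw -scalerBl intrB.
move=> p; rewrite ltnS leq_eqVlt => /predU1P[->|]; last exact: IH.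
move: f0; rewrite big_ord_recr big1 /= => [|q _]; last by apply: IH.
by rewrite add0r.
Qed.

(** Comparison of weight components in a decomposition into words. *)
Lemma wt_span n v : wt n v ->
  v = 0 \/ exists2 p : nat, n = p & lin_span (word L W Om p) v.
Proof.
move=> nv; have [f [N [fP vE]]] := graded_sum v.
have fw (p : nat) : wt p (f p).
  by apply: lin_span_min (fP p); [exact: wt_subspace|exact: wt_word].
have f0 (p : nat) : (p < N)%N -> p%:Z != n -> f p = 0.
  move=> pN pn; suff /eqP : (p%:Z - n)%:~R *: f p = 0.
    by rewrite scaler_eq0 intr_eq0 subr_eq0 (negPf pn) => /eqP.
  apply: (@wt_indep N (fun p => (p%:Z - n)%:~R *: f p)) pN => [q|].
    by apply: (subspaceZ _ (wt_subspace q)).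
  have /eqP := nv; rewrite vE -subr_eq0 linear_sum scaler_sumr -sumrB => /eqP E.
  by rewrite -[RHS]E; apply: eq_bigr => q _; rewrite fw -scalerBl intrB.
case: n nv f0 => n nv f0; last first.
  by left; rewrite vE big1 // => p _; apply: f0.
have [nN|nN] := ltnP n N; last first.
  by left; rewrite vE big1 // => p _; apply: f0 => //; have := ltn_ord p; lia.
right; exists n => //; rewrite vE (bigD1 (Ordinal nN)) //= big1 ?addr0 // => p pn.
apply: f0 => //; apply: contra_neq pn => -[pn]; exact: val_inj.
Qed.

Lemma wt_neg n v : n < 0 -> wt n v -> v = 0.
Proof. by move=> n0 /wt_span[//|[p np]]; lia. Qed.

End W3Grading.

(** * The vertex operator algebra of the representation *)

Section W3VertexOperatorAlgebra.
Context {R : realType} {V : lmodType R[i]}.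
Variables (c h w : R[i]) (L W : int -> {linear V -> V}) (Om : V).
Hypotheses (hrep : W3_representation c L W) (hlow : lowest_weight_vector L W h w Om).
Hypotheses (hcyc : cyclic_vector L W Om) (hvac : L (- 1) Om = 0).

Let X := W3_field hrep.
Let sf := state_field Om (L (-1)) X.

Lemma W3_field_cyclic (U : V -> Prop) : U Om ->
  (forall (a : R[i]) u v, U u -> U v -> U (a *: u + v)) ->
  (forall b n v, U v -> U (X b n v)) -> forall v, U v.
Proof.
move=> UOm Ulin UX; apply: (cyclic_ind hcyc) => //.
- by split=> //; rewrite -[0](addNr Om) -scaleN1r; apply: Ulin.
- by move=> n v /(UX true (n + 1)) /=; rewrite addrK.
- by move=> n v /(UX false (n + 2)) /=; rewrite addrK.
Qed.

Lemma W3_field_inj A B : sf A -> sf B -> A (-1) Om = B (-1) Om ->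
  forall n v, A n v = B n v.
Proof. by apply: state_field_inj => //; apply: W3_field_cyclic. Qed.

Lemma W3_field_local b b' : flocal (X b) (X b').
Proof.
case: b b' => [] [].
- exact: Lfield_local.
- exact: LWfield_local.
- exact/flocal_sym/LWfield_local.
- exact: Wfield_local.
Qed.

Lemma W3_field_covariant b : covariant (L (-1)) (X b).
Proof. by case: b; [apply: Lfield_cov|apply: Wfield_cov]. Qed.

Lemma W3_field_creative b : creative Om (X b).
Proof. by case: b; [apply: Lfield_creative hlow _|apply: Wfield_creative hlow _]. Qed.

Lemma W3_sf_gen b : sf (X b).
Proof.
split; [exact: W3_field_covariant|exact: W3_field_creative|].
by move=> b'; apply: W3_field_local.
Qed.

Lemma W3_sf_nprod b n A : sf A -> sf (nprod (X b) n A).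
Proof.
apply: state_field_nprod => *; [exact: W3_field_local|exact: W3_field_covariant|].
exact: W3_field_creative.
Qed.

(** A vertex algebra structure with the characterisation of its fields as the
    state fields, from which every identity between fields is derived by
    comparison of vacuum values. *)
Record state_field_map (Y : V -> @fld R V) : Prop := {
  sfm_sf : forall v, sf (Y v);
  sfm_vac : forall v, Y v (-1) Om = v;
  sfm_va : vertex_algebra (fun v n => Y v n) Om (L (-1)) }.

Lemma state_field_map_exists : exists Y, state_field_map Y.
Proof.
have [||||Y [sY Y1 vaY]] := @reconstruction R V Om (L (-1)) bool X hvac.
- exact: W3_field_local.
- exact: W3_field_covariant.
- exact: W3_field_creative.
- exact: W3_field_cyclic.
by exists Y.
Qed.

Section Structure.
Variable Y : V -> @fld R V.
Hypothesis hY : state_field_map Y.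

Lemma Y_unique A v : sf A -> A (-1) Om = v -> forall n u, Y v n u = A n u.
Proof.
move=> sA Av; apply: W3_field_inj => //; first exact: sfm_sf hY v.
by rewrite (sfm_vac hY).
Qed.

Lemma Y_gen b n u : Y (X b (-1) Om) n u = X b n u.
Proof. by apply: Y_unique => //; apply: W3_sf_gen. Qed.

(** Both fields are state fields with the same value on Om. *)
Lemma Y_nprod b m a n u : Y (X b m a) n u = nprod (X b) m (Y a) n u.
Proof.
apply: Y_unique; first exact: W3_sf_nprod (sfm_sf hY a).
have [_ ->] := nprod_vac m (W3_field_creative b) (sf_creat (sfm_sf hY a)).
by rewrite (sfm_vac hY).
Qed.

Lemma Y_L n u : Y (L (-2) Om) (n + 1) u = L n u.
Proof. by have := Y_gen true (n + 1) u; rewrite /= addrK. Qed.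

Lemma Y_W n u : Y (W (-3) Om) (n + 2) u = W n u.
Proof. by have := Y_gen false (n + 2) u; rewrite /= addrK. Qed.

Let Yf v n := Y v n : V -> V.

Lemma vir_L n : vir Yf (L (-2) Om) n = L n.
Proof. by apply/funext => v; apply: Y_L. Qed.

Lemma weight_vectorE n v : weight_vector Yf (L (-2) Om) n v <-> wt L n v.
Proof. by rewrite /weight_vector vir_L. Qed.

Theorem W3_voa : vertex_operator_algebra Yf Om (L (-1)) (L (-2) Om).
Proof.
split.
- exact: sfm_va hY.
- by exists c => m n v; rewrite !vir_L; apply: (W3_LL hrep).
- by move=> v; rewrite vir_L.
- move=> v; have [f [N [fP ->]]] := graded_sum hrep hlow hcyc hvac v.
  exists [seq p%:Z | p <- iota 0 N], (fun n => f `|n|%N); split.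
  + by rewrite map_inj_uniq ?iota_uniq // => p q [].
  + move=> n /mapP[p _ ->]; rewrite weight_vectorE /=.
    by apply: lin_span_min (fP p); [exact: wt_subspace|exact: (wt_word hrep hlow hvac)].
  + by rewrite big_map -(big_mkord xpredT f) /index_iota subn0.
- exists 0 => n v n0 /weight_vectorE; exact: (wt_neg hrep hlow hcyc hvac).
- move=> n; have [s sP] := word_finite L W Om (absz n).+1.
  exists (size s), (fun i => s`_i) => v /weight_vectorE /(wt_span hrep hlow hcyc hvac).
  case=> [->|[p np vp]].
    by exists (fun=> 0); rewrite big1 // => i _; rewrite scale0r.
  apply: (lin_span_seq _ vp) => u; apply: sP; lia.
Qed.

Theorem W3_generated : generated_by Yf Om L W.
Proof.
split; [exact: Y_L|exact: Y_W|move=> v].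
suff : lin_span (mode_monomial L W Om) v.
  elim=> [|a u {}v Pu _ [k [b [e [eP ->]]]]].
    by exists 0%N, (fun=> 0), (fun=> 0); split; [case|rewrite big_ord0].
  exists k.+1, (fun i => oapp b a (unlift ord0 i)), (fun i => oapp e u (unlift ord0 i)).
  split=> [i|]; first by case: unliftP => [j _|_] /=; [apply: eP|].
  rewrite big_ord_recl unlift_none /=; congr (_ + _).
  by apply: eq_bigr => i _; rewrite liftK.
apply: (cyclic_ind hcyc); first exact: lin_span_subspace.
- exact/lin_span_mem/mode_monomial_vac.
- move=> n u; apply: lin_span_map => {}u Pu.
  exact/lin_span_mem/mode_monomial_L.
- move=> n u; apply: lin_span_map => {}u Pu.
  exact/lin_span_mem/mode_monomial_W.
Qed.

End Structure.
End W3VertexOperatorAlgebra.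

(** * Conjugate modules and hermitian forms *)

Section ConjugateModule.
Context {R : realType}.

(** The complex conjugate module: scalars act through their conjugates. *)
Definition conjmod (V : lmodType R[i]) : Type := V.

HB.instance Definition _ (V : lmodType R[i]) := GRing.Zmodule.on (conjmod V).

Variable V : lmodType R[i].
Implicit Types (u v : conjmod V).

Definition conj_scale (a : R[i]) (v : conjmod V) : conjmod V := Num.conj a *: (v : V).

Lemma conj_scaleA a b v : conj_scale a (conj_scale b v) = conj_scale (a * b) v.
Proof. by rewrite /conj_scale scalerA rmorphM. Qed.

Lemma conj_scale1 : left_id 1 conj_scale.
Proof. by move=> v; rewrite /conj_scale rmorph1 scale1r. Qed.

Lemma conj_scaleDr : right_distributive conj_scale +%R.
Proof. by move=> a u v; apply: scalerDr. Qed.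

Lemma conj_scaleDl v : {morph conj_scale^~ v : a b / a + b}.
Proof. by move=> a b; rewrite /conj_scale rmorphD scalerDl. Qed.

HB.instance Definition _ := GRing.Zmodule_isLmodule.Build R[i] (conjmod V)
  conj_scaleA conj_scale1 conj_scaleDr conj_scaleDl.

(** Used with e = 1 for the modes L_n and e = -1 for the modes W_n. *)
Definition doubled (e : R[i]) (f : {linear V -> V}) (z : V * conjmod V) :
  V * conjmod V := (f z.1, (e *: f z.2 : V)).

Lemma doubled_linear e f : linear (doubled e f).
Proof.
move=> a [u u'] [v v']; rewrite /doubled /=; congr (_, _); first exact: linearP.
rewrite -[RHS]/(Num.conj a *: (e *: f u') + e *: f v' : V).
rewrite -[a *: u' + v']/(Num.conj a *: (u' : V) + (v' : V) : V).
by rewrite linearP scalerDr !scalerA mulrC.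
Qed.

HB.instance Definition _ e f :=
  GRing.isLinear.Build _ _ _ _ (doubled e f) (doubled_linear e f).

End ConjugateModule.

Section Forms.
Context {R : realType} {V : lmodType R[i]}.
Variables (f : {dot V for Num.conj}).
Implicit Types (u v x : V).

Lemma form_conj u v : f u v = Num.conj (f v u).
Proof. by have := @hermitian_subproof _ _ _ _ f u v; rewrite expr0 mul1r. Qed.

Lemma form_linl (a : R[i]) u v x : f (a *: u + v) x = a * f u x + f v x.
Proof. by rewrite linearDl linearZl_LR. Qed.

Lemma form_linr (a : R[i]) u v x : f x (a *: u + v) = Num.conj a * f x u + f x v.
Proof. by rewrite linearDr linearZr_LR. Qed.

Lemma form_addl u v x : f (u + v) x = f u x + f v x.
Proof. exact: linearDl. Qed.

Lemma form_addr u v x : f x (u + v) = f x u + f x v.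
Proof. exact: linearDr. Qed.

Lemma form_oppl u v : f (- u) v = - f u v.
Proof. exact: linearNl. Qed.

Lemma form_oppr u v : f u (- v) = - f u v.
Proof. exact: linearNr. Qed.

Lemma form_real u : Num.conj (f u u) = f u u.
Proof. by rewrite -form_conj. Qed.

Lemma form_eq0 u : f u u = 0 -> u = 0.
Proof. by move=> /eqP; rewrite dnorm_eq0 => /eqP. Qed.

Section Scaled.
Variable k : R[i].
Hypothesis k0 : 0 < k.

(** The positivity proof is an argument so that instances can depend on it. *)
Definition scaled_form (_ : 0 < k) u v : R[i] := k * f u v.

Lemma scaled_formBl v : zmod_morphism (scaled_form k0 ^~ v).
Proof. by move=> u u'; rewrite /scaled_form linearBl mulrBr. Qed.

Lemma scaled_formBr u : zmod_morphism (scaled_form k0 u).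
Proof. by move=> v v'; rewrite /scaled_form linearBr mulrBr. Qed.

Lemma scaled_formZl v : scalable_for *%R (scaled_form k0 ^~ v).
Proof. by move=> a u; rewrite /scaled_form linearZl_LR mulrCA. Qed.

Lemma scaled_formZr u : scalable_for (Num.conj \; *%R) (scaled_form k0 u).
Proof. by move=> a v; rewrite /scaled_form linearZr_LR mulrCA. Qed.

HB.instance Definition _ := isBilinear.Build R[i] V V R[i] *%R (Num.conj \; *%R)
  (scaled_form k0) scaled_formBl scaled_formBr scaled_formZl scaled_formZr.

Lemma scaled_form_hermitian u v :
  scaled_form k0 u v = (-1) ^+ false * Num.conj (scaled_form k0 v u).
Proof.
rewrite expr0 mul1r /scaled_form (form_conj u v) [RHS]rmorphM; congr (_ * _).
by apply/esym/CrealP; rewrite realE ltW.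
Qed.

HB.instance Definition _ := isHermitianSesquilinear.Build R[i] V false Num.conj
  (scaled_form k0) scaled_form_hermitian.

Lemma scaled_form_gt0 u : u != 0 -> 0 < scaled_form k0 u u.
Proof. by move=> u0; rewrite /scaled_form mulr_gt0 // dnorm_gt0. Qed.

HB.instance Definition _ := isDotProduct.Build R[i] V (scaled_form k0) scaled_form_gt0.

Definition scaled_dot : {dot V for Num.conj} := scaled_form k0.

End Scaled.
End Forms.

(** * The antilinear involution of a unitary representation *)

Section Conjugation.
Context {R : realType} {V : lmodType R[i]}.
Variables (c h w : R[i]) (L W : int -> {linear V -> V}) (Om : V).
Hypotheses (hrep : W3_representation c L W) (hlow : lowest_weight_vector L W h w Om).
Hypotheses (hcyc : cyclic_vector L W Om) (hvac : L (- 1) Om = 0).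
Variable f : {dot V for Num.conj}.
Hypothesis f_inv : invariant_form L W f.

Let fL n x y : f (L n x) y = f x (L (- n) y).
Proof. by have [H _] := f_inv; rewrite -(H (- n)) opprK. Qed.

Let fW n x y : f (W n x) y = f x (W (- n) y).
Proof. by have [_ H] := f_inv; rewrite -(H (- n)) opprK. Qed.

Let fLr n x y : f (L (- n) x) y = f x (L n y).
Proof. by case: f_inv. Qed.

Let fWr n x y : f (W (- n) x) y = f x (W n y).
Proof. by case: f_inv. Qed.

Let Om0 : Om != 0 := lwv_neq0 hlow.

Let L_Om n : -1 <= n -> L n Om = 0 := @L_vac _ _ _ _ _ _ _ _ hrep hlow hvac n.
Let W_Om n : -2 <= n -> W n Om = 0 := @W_vac _ _ _ _ _ _ _ _ hrep hlow hvac n.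

(** (L_-2 Om, L_-2 Om) is the conjugate of c / 2 times (Om, Om). *)
Lemma central_charge_real : Num.conj c = c.
Proof.
have nO : f Om Om != 0 by rewrite dnorm_eq0.
have E : L 2 (L (-2) Om) = (c / 2%:R) *: Om.
  have := W3_LL hrep 2 (-2) Om.
  rewrite /commutator (L_Om (n := 2)) // (linear0 (L _)) subr0 subrr.
  rewrite (L_Om (n := 0)) // scaler0 add0r => ->.
  congr (_ *: _).
  have -> : ((2 : int) * (2 ^+ 2 - 1))%:~R = 6%:R :> R[i] by [].
  rewrite eqxx mulr1.
  by field.
have := fL (-2) Om (L (-2) Om); rewrite opprK E linearZr_LR /= => H.
have H1 := form_real f (L (-2) Om).
have E2 : Num.conj (c / 2%:R) = f (L (-2) Om) (L (-2) Om) / f Om Om by rewrite H mulfK.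
have E3 : Num.conj (c / 2%:R) = c / 2%:R.
  rewrite -[RHS]conjCK E2 [RHS]fmorph_div.
  by congr (_ / _); apply/esym/form_real.
apply: (mulIf (x := 2%:R^-1)); first by rewrite invr_eq0 pnatr_eq0.
by rewrite -[RHS]E3 rmorphM fmorphV rmorph_nat.
Qed.

Let Z : lmodType R[i] := (V * conjmod V)%type.
Let LZ n : {linear Z -> Z} := doubled 1 (L n).
Let WZ n : {linear Z -> Z} := doubled (-1) (W n).
Let OmZ : Z := (Om, Om).

Lemma double_scale (a : R[i]) (x x' : V) : Num.conj a = a ->
  a *: ((x, x') : Z) = (a *: x, (a *: x' : V)) :> Z.
Proof. by move=> ar; rewrite -[in X in _ = (_, X)]ar. Qed.

Lemma double_commutator (e e' : R[i]) (g g' : {linear V -> V}) (x x' : V) :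
  commutator (doubled e g) (doubled e' g') ((x, x') : Z) =
  (commutator g g' x, ((e * e') *: commutator g g' x' : V)) :> Z.
Proof.
rewrite -[LHS]/((commutator g g' x,
  (e *: g (e' *: g' x') - e' *: g' (e *: g x') : V)) : Z).
congr (_, _).
by rewrite linearZ_LR (linearZ_LR g') /= !scalerA (mulrC e') -scalerBr.
Qed.

Let conj_int (n : int) : Num.conj (n%:~R : R[i]) = n%:~R.
Proof. exact: rmorph_int. Qed.

Let conj_nat (n : nat) : Num.conj (n%:R : R[i]) = n%:R.
Proof. exact: rmorph_nat. Qed.

Let conj_mul (a b : R[i]) : Num.conj a = a -> Num.conj b = b -> Num.conj (a * b) = a * b.
Proof. by move=> ar br; rewrite rmorphM; congr (_ * _). Qed.

Let conj_add (a b : R[i]) : Num.conj a = a -> Num.conj b = b -> Num.conj (a + b) = a + b.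
Proof. by move=> ar br; rewrite rmorphD; congr (_ + _). Qed.

Let conj_inv (a : R[i]) : Num.conj a = a -> Num.conj (a^-1) = a^-1.
Proof. by move=> ar; rewrite fmorphV; congr (_^-1). Qed.

Ltac realC := repeat first [ exact: conj_int | exact: conj_nat
  | exact: central_charge_real | apply: conj_mul | apply: conj_inv | apply: conj_add ].

(** The operators (L_n, L_n) and (W_n, -W_n) on the sum of V and its conjugate
    satisfy the relations of the W3-algebra, because the structure constants
    are real and even in W. *)
Lemma double_LL m n z : exists a b : R[i],
  commutator (LZ m) (LZ n) z = a *: LZ (m + n) z + b *: z.
Proof.
case: z => x x'; exists (m - n)%:~R.
exists (c / 12%:R * (m * (m ^+ 2 - 1))%:~R * (m + n == 0)%:R).
rewrite double_commutator !double_scale; last first.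
- exact: conj_int.
- by realC.
by rewrite mulr1 scale1r !(W3_LL hrep) scale1r.
Qed.

Lemma double_LW m n z : exists a : R[i],
  commutator (LZ m) (WZ n) z = a *: WZ (m + n) z.
Proof.
case: z => x x'; exists (2 * m - n)%:~R.
rewrite double_commutator double_scale; last exact: conj_int.
by rewrite !(W3_LW hrep) mul1r !scalerA (mulrC (-1)).
Qed.

Lemma double_WW m n z : exists a b d : R[i],
  commutator (WZ m) (WZ n) z =
    a *: z + b *: ((Lambda L (m + n) z.1, Lambda L (m + n) z.2) : Z) + d *: LZ (m + n) z.
Proof.
case: z => x x'.
exists (c / (3 * 5`!)%:R * ((m ^+ 2 - 4) * (m ^+ 2 - 1) * m)%:~R * (m + n == 0)%:R).
exists (bsq c * (m - n)%:~R).
exists (30%:R^-1 * ((m - n) * (2 * m ^+ 2 - m * n + 2 * n ^+ 2 - 8))%:~R).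
rewrite double_commutator !double_scale.
- by rewrite mulrNN mulr1 scale1r !(W3_WW hrep) scale1r.
- by realC.
- by rewrite /bsq; realC.
- by realC.
Qed.

Lemma double_Lambda n z (U : Z -> Prop) : subspace U ->
  (forall k, U (LZ k z)) -> (forall k l, U (LZ k (LZ l z))) ->
  U (Lambda L n z.1, Lambda L n z.2).
Proof.
case: z => x x' /= sU UL ULL.
have fieldL := W3_fieldL hrep.
have [J1 P1] := Lambda_bound fieldL n x.
have [J2 P2] := Lambda_bound fieldL n (x' : V).
rewrite (P1 (J1 + J2)%N) ?leq_addr // (P2 (J1 + J2)%N) ?leq_addl //.
set J := (J1 + J2)%N; set q := _ * _.
have qr : Num.conj q = q by rewrite /q; realC.
have -> : (\sum_(j < J) Lambda_term L n j x - q *: L n x,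
    (\sum_(j < J) Lambda_term L n j (x' : V) - q *: L n (x' : V) : V)) =
  ((\sum_(j < J) Lambda_term L n j x, (\sum_(j < J) Lambda_term L n j (x' : V) : V)) : Z)
   - q *: LZ n (x, x') :> Z.
  by rewrite double_scale // scale1r.
apply: (subspaceD sU); last by apply: (subspaceN sU); apply: (subspaceZ _ sU); exact: UL.
elim: J => [|J IH]; first by rewrite !big_ord0; exact: (subspace0 sU).
rewrite !big_ord_recr /=.
apply: (subspaceD (u := (_, _)) (v := (_, _)) sU) => //.
(* The J-th terms of both components are the components of one quadratic word. *)
have H := subspaceD sU (ULL (n - (J%:Z - 1)) (J%:Z - 1)) (ULL (- 2 - J%:Z) (n + 2 + J%:Z)).
by move: H; rewrite /= /doubled /= !scale1r.
Qed.

(** The graph of the involution: the subrepresentation of V plus its conjugate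
    that is generated by (Om, Om). *)
Definition conj_graph (z : Z) : Prop := forall U : Z -> Prop, subspace U -> U OmZ ->
  (forall n v, U v -> U (LZ n v)) -> (forall n v, U v -> U (WZ n v)) -> U z.

Lemma conj_graph_subspace : subspace conj_graph.
Proof.
split=> [U sU *|a u v gu gv U sU UOm UL UW]; first exact: subspace0.
by apply: (subspaceP sU); [apply: gu|apply: gv].
Qed.

Lemma conj_graph_vac : conj_graph OmZ.
Proof. by []. Qed.

Lemma conj_graph_lin a (u u' v v' : V) : conj_graph (u, u') -> conj_graph (v, v') ->
  conj_graph (a *: u + v, Num.conj a *: u' + v').
Proof. exact: (subspaceP conj_graph_subspace). Qed.

Lemma conj_graph_L n (u u' : V) : conj_graph (u, u') -> conj_graph (L n u, L n u').
Proof.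
move=> gu U sU UOm UL UW; have := UL n _ (gu U sU UOm UL UW).
by rewrite /= /doubled scale1r.
Qed.

Lemma conj_graph_W n (u u' : V) : conj_graph (u, u') -> conj_graph (W n u, - W n u').
Proof.
move=> gu U sU UOm UL UW; have := UW n _ (gu U sU UOm UL UW).
by rewrite /= /doubled scaleN1r.
Qed.

Lemma conj_graph_ind (P : V -> V -> Prop) : P 0 0 -> P Om Om ->
  (forall a u u' v v', P u u' -> P v v' -> P (a *: u + v) (Num.conj a *: u' + v')) ->
  (forall n u u', P u u' -> P (L n u) (L n u')) ->
  (forall n u u', P u u' -> P (W n u) (- W n u')) ->
  forall u u', conj_graph (u, u') -> P u u'.
Proof.
move=> P0 POm Plin PL PW u u' /(_ (fun z => P z.1 z.2)); apply => //.
- by split=> [|a [x x'] [y y'] Px Py] //; apply: Plin.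
- by move=> n [x x'] Px /=; rewrite scale1r; apply: PL.
- by move=> n [x x'] Px /=; rewrite scaleN1r; apply: PW.
Qed.

Lemma conj_graph_sym (u u' : V) : conj_graph (u, u') -> conj_graph (u', u).
Proof.
move: u u'; apply: conj_graph_ind.
- exact: (subspace0 conj_graph_subspace).
- exact: conj_graph_vac.
- move=> a u u' v v' gu gv; rewrite -[a in X in conj_graph (_, X)]conjCK.
  exact: conj_graph_lin.
- by move=> n u u'; apply: conj_graph_L.
- move=> n u u' /(conj_graph_W n)/(subspaceN conj_graph_subspace) g.
  by have := g; rewrite -[W n u in X in _ -> X]opprK.
Qed.

Lemma conj_graph_total u : exists u' : V, conj_graph (u, u').
Proof.
move: u; apply: (cyclic_ind hcyc).
- split=> [|a u v [u' gu] [v' gv]].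
    by exists 0; apply: (subspace0 conj_graph_subspace).
  by exists (Num.conj a *: u' + v'); apply: conj_graph_lin.
- by exists Om; apply: conj_graph_vac.
- by move=> n u [u' gu]; exists (L n u'); apply: conj_graph_L.
- by move=> n u [u' gu]; exists (- W n u'); apply: conj_graph_W.
Qed.

(** By straightening it suffices to test nonempty words of negative modes,
    which are orthogonal to Om, and Om itself. *)
Lemma form_conj_graph_vac (v v' : V) : conj_graph (v, v') ->
  f Om v = Num.conj (f Om v').
Proof.
move=> gv; pose U (z : Z) := f Om z.1 = Num.conj (f Om (z.2 : V)).
apply: (@word_span _ _ LZ WZ OmZ _ _ _ _ _ U _ _ (v, v')) => //.
- move=> m n z U' sU Uz UL; have [a [b ->]] := double_LL m n z.
  by apply: (subspaceP sU) => //; apply: (subspaceZ _ sU).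
- move=> m n z U' sU UWz; have [a ->] := double_LW m n z.
  by apply: (subspaceZ _ sU).
- move=> m n z U' sU Uz UL ULL; have [a [b [d ->]]] := double_WW m n z.
  apply: (subspaceD sU); last exact: (subspaceZ _ sU).
  apply: (subspaceP sU) => //; apply: (subspaceZ _ sU).
  exact: double_Lambda.
- by move=> n n0; rewrite /= /doubled /= L_Om ?scaler0 //; lia.
- by move=> n n0; rewrite /= /doubled /= W_Om ?scaler0 //; lia.
- split=> [|a [x x'] [y y']]; rewrite /U /=.
    rewrite -[LHS]/(f Om 0) -[X in _ = Num.conj X]/(f Om 0) linear0r.
    exact/esym/conjC0.
  move=> Hx Hy; rewrite form_linr Hx Hy.
  rewrite -[a *: x' + y']/(Num.conj a *: (x' : V) + (y' : V)) form_linr.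
  by rewrite rmorphD rmorphM conjCK.
- move=> p z [d]; case: z / => [|a d' p' [x x'] _|a d' p' [x x'] _]; rewrite /U /=.
  + by rewrite -form_conj.
  + by rewrite scale1r -!fLr opprK L_Om // !linear0l conjC0.
  + have W0 (y : V) : f Om (W (- a.+1%:Z) y) = 0 by rewrite -fWr opprK W_Om // linear0l.
    rewrite W0 scaleN1r linearNr -[X in _ = Num.conj (- X)]/(f Om (W (- a.+1%:Z) x')).
    by rewrite W0 oppr0 conjC0.
Qed.

(** The modes of u are moved to the other side of the form. *)
Lemma form_conj_graph (u u' v v' : V) : conj_graph (u, u') -> conj_graph (v, v') ->
  f u v = Num.conj (f u' v').
Proof.
move=> gu; move: u u' gu v v'; apply: conj_graph_ind.
- by move=> v v' _; rewrite !linear0l rmorph0.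
- exact: form_conj_graph_vac.
- move=> a u u' v v' Hu Hv x x' gx; rewrite !form_linl (Hu _ _ gx) (Hv _ _ gx).
  by rewrite [RHS]rmorphD [in RHS]rmorphM /= conjCK.
- by move=> n u u' Hu v v' gv; rewrite !fL; apply: Hu; apply: conj_graph_L.
- move=> n u u' Hu v v' gv.
  have -> : f (- W n u') v' = f u' (- W (- n) v').
    by rewrite form_oppl form_oppr fW.
  by rewrite fW; apply: Hu; apply: conj_graph_W.
Qed.

(** A vector d related to 0 is orthogonal to every vector, since every vector is
    related to some vector. *)
Lemma conj_graph_fun (u u1 u2 : V) : conj_graph (u, u1) -> conj_graph (u, u2) -> u1 = u2.
Proof.
move=> g1 g2; apply/eqP; rewrite -subr_eq0; apply/eqP/(form_eq0 (f := f)).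
set d := u1 - u2.
have gd : conj_graph (0, d).
  have := conj_graph_lin (-1) g2 g1.
  by rewrite rmorphN1 !scaleN1r addNr addrC.
have [d' /conj_graph_sym gd'] := conj_graph_total d.
by rewrite -[LHS]conjCK -(form_conj_graph gd gd') linear0l rmorph0.
Qed.

Lemma conjugation_exists : exists theta : V -> V,
  [/\ forall a u v, theta (a *: u + v) = Num.conj a *: theta u + theta v,
      involutive theta, theta Om = Om,
      forall n v, theta (L n v) = L n (theta v)
    & forall n v, theta (W n v) = - W n (theta v)].
Proof.
have [theta tP] := choice conj_graph_total; exists theta.
have tE u u' : conj_graph (u, u') -> theta u = u' by apply: conj_graph_fun (tP u).
split=> [a u v|u||n v|n v]; apply: tE.
- exact: conj_graph_lin.
- by apply: conj_graph_sym; apply: tP.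
- exact: conj_graph_vac.
- by apply: conj_graph_L; apply: tP.
- by apply: conj_graph_W; apply: tP.
Qed.

End Conjugation.

(** * Invariance of the form, unitarity and simplicity *)

(** Summation of an array of finite support along antidiagonals. *)
Lemma triangle_sum (M : zmodType) (t : nat -> nat -> M) (I J K : nat) :
  (forall l i, (J <= l)%N -> t l i = 0) -> (forall l i, (I <= i)%N -> t l i = 0) ->
  (I + J <= K)%N ->
  \sum_(i < K) \sum_(l < i.+1) t l (i - l)%N = \sum_(l < J) \sum_(i < I) t l i.
Proof.
elim: J K t => [|J IH] K t tJ tI IJK.
  by rewrite big_ord0 big1 // => i _; rewrite big1 // => l _; apply: tJ.
under eq_bigr => i _ do rewrite big_ord_recl.
rewrite big_split big_ord_recl /=; congr (_ + _).
  have -> : K = (I + (K - I))%N by lia.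
  rewrite big_split_ord /= [X in _ + X = _]big1 ?addr0.
    by apply: eq_bigr => i _; rewrite subn0.
  by move=> i _; apply: tI; lia.
case: K IJK => [|K] IJK; first by lia.
rewrite big_ord_recl big_ord0 add0r -(IH K (fun l i => t l.+1 i)); try lia.
- by apply: eq_bigr => i _; apply: eq_bigr => l _.
- by move=> l i Jl; apply: tJ.
- by move=> l i Ii; apply: tI.
Qed.

Lemma uniform_bound (P : nat -> nat -> Prop) (I : nat) :
  (forall i, exists J0, forall J, (J0 <= J)%N -> P i J) ->
  exists J0, forall J, (J0 <= J)%N -> forall i, (i < I)%N -> P i J.
Proof.
move=> PJ; elim: I => [|I [J0 IH]]; first by exists 0%N.
have [J1 J1P] := PJ I; exists (J0 + J1)%N => J JJ i.
rewrite ltnS leq_eqVlt => /predU1P[->|iI]; first by apply: J1P; lia.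
by apply: IH => //; lia.
Qed.

Section Unitary.
Context {R : realType} {V : lmodType R[i]}.
Variables (c h w : R[i]) (L W : int -> {linear V -> V}) (Om : V).
Hypotheses (hrep : W3_representation c L W) (hlow : lowest_weight_vector L W h w Om).
Hypotheses (hcyc : cyclic_vector L W Om) (hvac : L (- 1) Om = 0).
Variable Y : V -> @fld R V.
Hypothesis hY : state_field_map Om hrep Y.
Let X := W3_field hrep.
Let sf := state_field Om (L (-1)) X.

(** The weights of L_-2 Om and W_-3 Om. *)
Definition gen_weight (b : bool) : nat := if b then 2 else 3.
Let d := gen_weight.

Section Theta.
Variable theta : V -> V.
Hypothesis thetaP : forall a u v, theta (a *: u + v) = Num.conj a *: theta u + theta v.
Hypothesis thetaK : involutive theta.
Hypothesis theta_vac : theta Om = Om.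
Hypothesis theta_L : forall n v, theta (L n v) = L n (theta v).
Hypothesis theta_W : forall n v, theta (W n v) = - W n (theta v).

Lemma theta0 : theta 0 = 0.
Proof.
by have := thetaP (-1) 0 0; rewrite scaler0 addr0 rmorphN1 scaleN1r addNr.
Qed.

Lemma thetaZ a u : theta (a *: u) = Num.conj a *: theta u.
Proof. by rewrite -[a *: u]addr0 thetaP theta0 addr0. Qed.

Lemma thetaD u v : theta (u + v) = theta u + theta v.
Proof. by rewrite -[u]scale1r thetaP rmorph1 !scale1r. Qed.

Lemma thetaN u : theta (- u) = - theta u.
Proof. by rewrite -scaleN1r thetaZ rmorphN1 scaleN1r. Qed.

Lemma thetaB u v : theta (u - v) = theta u - theta v.
Proof. by rewrite thetaD thetaN. Qed.

(** L has even and W has odd weight, so the sign is the parity of the weight. *)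
Lemma theta_X b m v : theta (X b m v) = (-1) ^+ d b *: X b m (theta v).
Proof.
case: b => /=; first by rewrite sqrrN expr1n scale1r theta_L.
by rewrite theta_W exprS sqrrN expr1n mulr1 scaleN1r.
Qed.

Definition theta_mode a n v := theta (Y a n (theta v)).

Lemma theta_mode_linear a n : linear (theta_mode a n).
Proof.
by move=> k u v; rewrite /theta_mode thetaP linearP thetaP conjCK.
Qed.

Lemma theta_mode_field a : is_field (theta_mode a).
Proof.
move=> v; have [N NP] := fldP (Y a) (theta v).
by exists N => n Nn; rewrite /theta_mode NP ?theta0.
Qed.

Definition theta_field a : @fld R V := mkfld (theta_mode_linear a) (theta_mode_field a).

(** Conjugation by theta preserves each of the defining properties of a state
    field, as theta commutes with L_n and anticommutes with W_n. *)
Lemma theta_field_sf a : sf (theta_field a).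
Proof.
have [Ycov Ycre Yloc] := sfm_sf hY a.
split.
- move=> n v; have := Ycov n (theta v); rewrite /commutator /= /theta_mode => E.
  rewrite -(theta_L (-1) (Y a n (theta v))) (theta_L (-1) v) -thetaB E thetaN thetaZ.
  by congr (- (_ *: _)); apply: rmorph_int.
- by move=> n n0; rewrite /= /theta_mode theta_vac Ycre // theta0.
- move=> b; have [N NP] := Yloc b; exists N => v m n.
  pose D p q := commutator (X b p) (Y a q) (theta v).
  have E p q : commutator (X b p) (theta_field a q) v = (-1) ^+ d b *: theta (D p q).
    rewrite /D /commutator /= /theta_mode theta_X linearZ /= thetaZ thetaB scalerBr.
    rewrite theta_X scalerA -exprMn mulrNN mulr1 expr1n scale1r.
    by congr (_ - _ *: _); rewrite rmorphXn rmorphN1.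
  have K s p q : iter s mul_zw (fun p q => (-1) ^+ d b *: theta (D p q)) p q =
      (-1) ^+ d b *: theta (iter s mul_zw D p q).
    by elim: s p q => //= s IH p q; rewrite /mul_zw !IH thetaB scalerBr.
  by rewrite (iter_mul_zw_ext _ E) K [iter _ _ _ _ _]NP theta0 scaler0.
Qed.

Lemma theta_Y a n u : theta (Y a n u) = Y (theta a) n (theta u).
Proof.
have E : theta_field a (-1) Om = theta a.
  by rewrite /= /theta_mode theta_vac (sfm_vac hY).
rewrite (Y_unique hcyc hvac hY (theta_field_sf a) E) /= /theta_mode.
by rewrite thetaK.
Qed.

Lemma theta_automorphism :
  antilinear_automorphism (fun v n => Y v n) Om (L (-2) Om) theta.
Proof.
split=> //; first by exists theta.
- by rewrite theta_L theta_vac.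
- exact: theta_Y.
Qed.

Section Invariance.
Variable f : {dot V for Num.conj}.
Hypothesis f_inv : invariant_form L W f.

(** The generating vectors are quasi-primary, of weight d. *)
Lemma gen_L1 b m v :
  commutator (L 1) (X b m) v = X b (m + 1) v *~ (2 * (d b)%:Z - 2 - m).
Proof.
rewrite -scaler_int; case: b => /=.
- rewrite (W3_LL hrep).
  have -> : (1 : int) * (1 ^+ 2 - 1) = 0 by [].
  rewrite mulr0z mulr0 mul0r scale0r addr0; congr (_%:~R *: L _ v); lia.
- by rewrite (W3_LW hrep); congr (_%:~R *: W _ v); lia.
Qed.

Lemma gen_wt b m n v : wt L n v -> wt L (n + (d b)%:Z - m - 1) (X b m v).
Proof.
move=> nv; case: b => /=.
- have -> : n + 2 - m - 1 = n - (m - 1) by lia.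
  exact: (wt_L hrep).
- have -> : n + 3 - m - 1 = n - (m - 2) by lia.
  exact: (wt_W hrep).
Qed.

(** Invariance of the form for the quasi-primary generators; the sign (-1)^d
    is carried by theta. *)
Lemma gen_adjoint b k u v : f (X b (2 * (d b)%:Z - 2 - k) u) v = f u (X b k v).
Proof.
have [fL fW] := f_inv; case: b => /=.
- by rewrite -fL; congr (f (L _ u) v); lia.
- by rewrite -fW; congr (f (W _ u) v); lia.
Qed.

(** L_1^i / i! a. *)
Definition divpow (i : nat) (a : V) : V := (i`!%:R)^-1 *: iter i (L 1) a.

Lemma divpow0 a : divpow 0 a = a.
Proof. by rewrite /divpow fact0 invr1 scale1r. Qed.

Lemma divpowS i a : L 1 (divpow i a) = divpow i.+1 a *~ i.+1%:Z.
Proof.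
rewrite /divpow linearZ_LR /= -scaler_int scalerA factS natrM invfM mulrA.
by rewrite divff ?mul1r // pnatr_eq0.
Qed.

(** Leibniz rule: each commutator with L_1 raises m by one and lowers the
    factor 2d - 2 - m by one, so that the divided powers give binomial
    coefficients. *)
Lemma divpow_gen b m i a : divpow i (X b m a) =
  \sum_(l < i.+1) X b (m + l%:Z) (divpow (i - l) a) *~ gbin (2 * (d b)%:Z - 2 - m) l.
Proof.
set p := 2 * _ - 2 - m.
elim: i => [|i IH].
  by rewrite big_ord1 gbin0 /= !divpow0 addr0.
have inj (x y : V) : x *~ i.+1%:Z = y *~ i.+1%:Z -> x = y.
  rewrite -(scaler_int _ x) -(scaler_int _ y) => /scalerI; apply.
  by rewrite pnatr_eq0.
apply: inj; rewrite -divpowS IH linear_sum mulrz_suml.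
pose E l := X b (m + l%:Z) (divpow (i.+1 - l) a).
(* The commutator with L_1 splits each summand into multiples of E l and
   E l.+1; regrouped, E l gets the factor (i + 1 - l) + l. *)
transitivity (\sum_(l < i.+1)
    (E l *~ (gbin p l * (i.+1%:Z - l%:Z)) + E l.+1 *~ (gbin p l.+1 * l.+1%:Z))).
  apply: eq_bigr => l _; have li := ltn_ord l.
  rewrite raddfMz /=.
  have -> : L 1 (X b (m + l%:Z) (divpow (i - l) a)) =
     E l *~ (i.+1%:Z - l%:Z) + E l.+1 *~ (p - l%:Z).
    have := gen_L1 b (m + l%:Z) (divpow (i - l) a).
    rewrite /commutator divpowS => /eqP; rewrite subr_eq => /eqP ->.
    rewrite addrC raddfMz /E; congr (_ *~ _ + _ *~ _).
    - by congr (X b _ (divpow _ a)); lia.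
    - by lia.
    - by rewrite subSS; congr (X b _ _); lia.
    - by rewrite /p; lia.
  by rewrite mulrzDl -!mulrzA gbin_absorb !(mulrC (gbin p l)).
rewrite big_split /=.
have -> : \sum_(l < i.+1) E l *~ (gbin p l * (i.+1%:Z - l%:Z)) =
    \sum_(l < i.+2) E l *~ (gbin p l * (i.+1%:Z - l%:Z)).
  by rewrite [RHS]big_ord_recr /= subrr mulr0 mulr0z addr0.
have -> : \sum_(l < i.+1) E l.+1 *~ (gbin p l.+1 * l.+1%:Z) =
    \sum_(l < i.+2) E l *~ (gbin p l * l%:Z).
  by rewrite [RHS]big_ord_recl /= mulr0 mulr0z add0r.
rewrite -big_split; apply: eq_bigr => l _ /=.
by rewrite -mulrzDr -mulrDr subrK mulrzA.
Qed.


Lemma YP k u v n b : Y (k *: u + v) n b = k *: Y u n b + Y v n b.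
Proof. exact: (va_linearl (sfm_va hY)). Qed.

Lemma Y0 n b : Y 0 n b = 0.
Proof. by have := YP (-1) 0 0 n b; rewrite scaler0 addr0 scaleN1r addNr. Qed.

Lemma YZ k u n b : Y (k *: u) n b = k *: Y u n b.
Proof. by rewrite -[k *: u]addr0 YP Y0 addr0. Qed.

Lemma divpow_bound n a : wt L n a ->
  exists I0, forall i, (I0 <= i)%N -> divpow i a = 0.
Proof.
move=> na; exists (absz n).+1 => i ni; rewrite /divpow.
have wi j : wt L (n - j%:Z) (iter j (L 1) a).
  elim: j => [|j IH] /=; first by rewrite subr0.
  have -> : n - j.+1%:Z = n - j%:Z - 1 by lia.
  exact: (wt_L hrep).
by rewrite (wt_neg hrep hlow hcyc hvac _ (wi i)) ?scaler0 //; lia.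
Qed.

Lemma divpowP i k u v : divpow i (k *: u + v) = k *: divpow i u + divpow i v.
Proof.
rewrite /divpow.
have -> : iter i (L 1) (k *: u + v) = k *: iter i (L 1) u + iter i (L 1) v.
  by elim: i => //= i ->; rewrite linearP.
by rewrite scalerDr !scalerA mulrC.
Qed.

(** The coefficient of z^(-k-1) in Y(e^(z L_1) (-z^-2)^(L_0) a, z^-1) u for a of
    weight n. *)
Definition opposite (n : int) (a : V) (k : int) (u : V) : V :=
  (-1) ^ n *: \sum_(j \in [set: nat]%classic)
    (j`!%:R)^-1 *: Y (iter j (L 1) a) (2 * n - j%:Z - k - 2) u.

Lemma oppositeE n a k u I : (forall i, (I <= i)%N -> divpow i a = 0) ->
  opposite n a k u =
    (-1) ^ n *: \sum_(i < I) Y (divpow i a) (2 * n - i%:Z - k - 2) u.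
Proof.
move=> aI; rewrite /opposite (@fsum_ord _ _ I) => [|j /aI]; last first.
  by rewrite -YZ -/(divpow j a) => ->; rewrite Y0.
by congr (_ *: _); apply: eq_bigr => i _; rewrite -YZ.
Qed.

(** The invariance of the form for the homogeneous vector a. *)
Definition has_adjoint n a := wt L n a /\
  forall k u v, f (opposite n a k u) v = f u (Y (theta a) k v).

Lemma has_adjoint_subspace n : subspace (has_adjoint n).
Proof.
have w0 := subspace0 (wt_subspace L n); split.
  split=> // k u v; rewrite (@oppositeE n 0 k u 0) => [|i _].
    by rewrite big_ord0 scaler0 theta0 Y0 !linear0l linear0r.
  rewrite /divpow; have -> : iter i (L 1) 0 = 0 by elim: i => //= i ->; rewrite linear0.
  by rewrite scaler0.
move=> a x y [nx Hx] [ny Hy]; split; first exact: (subspaceP (wt_subspace L n)).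
move=> k u v; have [I1 P1] := divpow_bound nx; have [I2 P2] := divpow_bound ny.
pose I := (I1 + I2)%N.
have Px i : (I <= i)%N -> divpow i x = 0 by move=> Ii; apply: P1; move: Ii; rewrite /I; lia.
have Py i : (I <= i)%N -> divpow i y = 0 by move=> Ii; apply: P2; move: Ii; rewrite /I; lia.
have Pxy i : (I <= i)%N -> divpow i (a *: x + y) = 0.
  by move=> Ii; rewrite divpowP Px ?Py // scaler0 addr0.
have -> : opposite n (a *: x + y) k u = a *: opposite n x k u + opposite n y k u.
  rewrite (oppositeE _ _ _ Px) (oppositeE _ _ _ Py) (oppositeE _ _ _ Pxy).
  rewrite scalerA (mulrC a) -scalerA -scalerDr; congr (_ *: _).
  rewrite scaler_sumr -big_split /=.
  by apply: eq_bigr => i _; rewrite divpowP YP.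
by rewrite form_linl Hx Hy thetaP YP form_linr conjCK.
Qed.

Lemma has_adjoint_vac : has_adjoint 0 Om.
Proof.
split; first exact: (wt_vac hrep hlow hvac).
have vacY n v : Y Om n v = (n == -1)%:R *: v by apply: (va_vacuum (sfm_va hY)).
move=> k u v; rewrite (@oppositeE 0 Om k u 1) => [|[//|i] _]; last first.
  rewrite /divpow iterSr (L_vac hrep hlow hvac) //.
  have -> : iter i (L 1) 0 = 0 by elim: (i) => //= ? ->; rewrite linear0.
  by rewrite scaler0.
rewrite big_ord1 expr0z scale1r divpow0 theta_vac !vacY.
have -> : (2 * 0 - 0%N%:Z - k - 2 == -1) = (k == -1) by lia.
by rewrite linearZl_LR linearZr_LR /= rmorph_nat.
Qed.


Lemma form_sum_mulz (J : nat) (F : nat -> V) (s : nat -> int) v :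
  f (\sum_(j < J) F j *~ s j) v = \sum_(j < J) f (F j) v *~ s j.
Proof.
elim: J => [|J IH]; first by rewrite !big_ord0 linear0l.
rewrite !big_ord_recr /= -IH -scaler_int addrC form_linl addrC; congr (_ + _).
by rewrite mulrzl.
Qed.

Lemma form_sum_mulzr (J : nat) (F : nat -> V) (s : nat -> int) v :
  f v (\sum_(j < J) F j *~ s j) = \sum_(j < J) f v (F j) *~ s j.
Proof.
elim: J => [|J IH]; first by rewrite !big_ord0 linear0r.
rewrite !big_ord_recr /= -IH -scaler_int addrC form_linr addrC; congr (_ + _).
by rewrite rmorph_int mulrzl.
Qed.

(** The opposite modes of X_(m) a.  After [divpow_gen] the sum over the
    binomial coefficients C(p, l), p = 2d - 2 - m, is by the Borcherds identity
    a single coefficient, with exponent -p-1 of z, of the commutator of X(z)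
    with Y(L_1^i/i! a, w) weighted by (z - w)^m.  It has again the form of an
    m-th product, with the order of the factors reversed. *)
Lemma opposite_gen n a b m k u : wt L n a ->
  exists J0, forall J, (J0 <= J)%N ->
  opposite (n + (d b)%:Z - m - 1) (X b m a) k u =
   (-1) ^ (n + (d b)%:Z - m - 1 + n) *:
   (\sum_(j < J) X b (2 * (d b)%:Z - 2 - j%:Z) (opposite n a (k + m - j%:Z) u) *~ sbin m j
    - (-1) ^ m *: \sum_(j < J) opposite n a (k + j%:Z)
        (X b (2 * (d b)%:Z - 2 - m + j%:Z) u) *~ sbin m j).
Proof.
move=> na; set N := n + _ - m - 1; set p := 2 * _ - 2 - m.
have [I aI] := divpow_bound na.
pose A i := Y (divpow i a).
pose r i : int := 2 * n - i%:Z - k - 2.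
have [J1 P1] := @uniform_bound (fun i J => forall n' k', expansion (X b) (A i) n' k' (r i - m) u =
    \sum_(j < J) X b (n' + k' - j%:Z) (A i (r i - m + j%:Z) u) *~ sbin n' j) I
  (fun i => expansion_bound (X b) (A i) (r i - m) u).
have [J2 P2] := @uniform_bound (fun i J => forall n' k', expansion (A i) (X b) n' k' p u =
    \sum_(j < J) A i (n' + k' - j%:Z) (X b (p + j%:Z) u) *~ sbin n' j) I
  (fun i => expansion_bound (A i) (X b) p u).
have [K PK] : exists K, forall l i, (K <= l)%N -> X b (m + l%:Z) (divpow i a) = 0.
  have [K PK] := @uniform_bound (fun i J =>
      forall l, (J <= l)%N -> X b (m + l%:Z) (divpow i a) = 0) I
    (fun i => let: ex_intro J0 JP := fld_bound (X b) (divpow i a) m in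
      ex_intro _ J0 (fun J JJ l Jl => JP l (leq_trans JJ Jl))).
  exists K => l i Kl; have [iI|Ii] := ltnP i I; first exact: (PK K).
  by rewrite aI // linear0.
have oppX : opposite N (X b m a) k u =
    (-1) ^ N *: \sum_(i < I) borcherds (X b) (A i) m p (r i - m) u.
  rewrite (@oppositeE _ _ _ _ (I + K)) => [|i Ii]; last first.
    rewrite divpow_gen big1 // => l _.
    have [Kl|lK] := leqP K l; first by rewrite PK ?mul0rz.
    by rewrite aI ?linear0 ?mul0rz //; lia.
  congr (_ *: _).
  pose t l i := Y (X b (m + l%:Z) (divpow i a)) (2 * N - (i + l)%N%:Z - k - 2) u *~ gbin p l.
  transitivity (\sum_(i < I + K) \sum_(l < i.+1) t l (i - l)%N).
    apply: eq_bigr => i _; rewrite divpow_gen -/p.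
    have Ysum (s : nat) (F : nat -> V) (z : nat -> int) n' :
        Y (\sum_(l < s) F l *~ z l) n' u = \sum_(l < s) Y (F l) n' u *~ z l.
      elim: s => [|s IHs]; first by rewrite !big_ord0 Y0.
      rewrite !big_ord_recr /= -IHs -scaler_int addrC YP addrC; congr (_ + _).
      by rewrite scaler_int.
    rewrite (Ysum _ (fun l => X b (m + l%:Z) (divpow (i - l) a))).
    by apply: eq_bigr => l _; rewrite /t subnK // -ltnS.
  (* Only i < I and l < K contribute, so the triangle is a rectangle. *)
  rewrite (@triangle_sum _ t I K) //; first last.
  - by move=> l i Ii; rewrite /t aI // linear0 Y0 mul0rz.
  - by move=> l i Kl; rewrite /t PK // Y0 mul0rz.
  rewrite exchange_big; apply: eq_bigr => i _ /=.
  have XA : flocal (X b) (A i) by apply: sf_local (sfm_sf hY _) b.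
  rewrite (borcherds_identity _ _ _ _ XA) (@fsum_ord _ _ K) => [|l Kl]; last first.
    by rewrite -(Y_nprod hlow hcyc hvac hY) PK // Y0 mul0rz.
  apply: eq_bigr => l _; rewrite -(Y_nprod hlow hcyc hvac hY) /t; congr (Y _ _ u *~ _).
  by rewrite /r /N /p PoszD; lia.
exists (J1 + J2)%N => J JJ.
rewrite oppX (expfzDr N n) ?oppr_eq0 ?oner_eq0 // -scalerA; congr (_ *: _).
have oppS k' u' : (-1) ^ n *: opposite n a k' u' =
    \sum_(i < I) A i (2 * n - i%:Z - k' - 2) u'.
  by rewrite (oppositeE _ _ _ aI) scalerA -expfzMl mulrNN mulr1 exp1rz scale1r.
rewrite /borcherds sumrB -scaler_sumr scalerBr scalerA (mulrC ((-1) ^ n)) -scalerA.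
congr (_ - _ *: _).
- transitivity (\sum_(i < I) \sum_(j < J)
      X b (2 * (d b)%:Z - 2 - j%:Z) (A i (r i - m + j%:Z) u) *~ sbin m j).
    apply: eq_bigr => i _; rewrite (P1 J) //; last by lia.
    apply: eq_bigr => j _; congr (X b _ _ *~ _); rewrite /p; lia.
  rewrite exchange_big scaler_sumr; apply: eq_bigr => j _ /=.
  rewrite -mulrz_suml -linear_sum -scalerMzr -linearZ_LR oppS; congr (X b _ _ *~ _).
  by apply: eq_bigr => i _; congr (A i _ u); rewrite /r; lia.
- transitivity (\sum_(i < I) \sum_(j < J)
      A i (m + (r i - m) - j%:Z) (X b (p + j%:Z) u) *~ sbin m j).
    by apply: eq_bigr => i _; rewrite (P2 J) //; lia.
  rewrite exchange_big scaler_sumr; apply: eq_bigr => j _ /=.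
  rewrite -mulrz_suml -scalerMzr oppS; congr (_ *~ _).
  by apply: eq_bigr => i _; congr (A i _ _); rewrite /r; lia.
Qed.

Lemma sign_int (n : int) : ((-1 : R[i]) ^ n = 1) \/ ((-1 : R[i]) ^ n = -1).
Proof.
case: n => n; rewrite ?NegzE -?invr_expz -?exprnP -signr_odd.
  by case: odd; [right|left].
by case: odd; [right; rewrite invrN invr1|left; rewrite invr1].
Qed.

Lemma conj_sign (n : int) : Num.conj ((-1 : R[i]) ^ n) = (-1) ^ n.
Proof. by case: (sign_int n) => ->; rewrite ?rmorphN1 ?rmorph1. Qed.

Lemma sign_sq (n : int) : (-1 : R[i]) ^ n * (-1) ^ n = 1.
Proof. by rewrite -expfzMl mulrNN mulr1 exp1rz. Qed.

Lemma sign_weight n b m : (-1 : R[i]) ^ (n + (d b)%:Z - m - 1 + n) =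
  - ((-1) ^+ d b * (-1) ^ m).
Proof.
have N0 : (-1 : R[i]) != 0 by rewrite oppr_eq0 oner_eq0.
have -> : n + (d b)%:Z - m - 1 + n = (n - m - 1) + (n - m - 1) + ((d b)%:Z + (m + 1)) by lia.
rewrite (expfzDr _ _ N0) (expfzDr (n - m - 1)) // sign_sq mul1r.
by rewrite !(expfzDr _ _ N0) expr1z mulrN1 mulrN.
Qed.

(** Taking adjoints reverses the order of factors once more, so the formula of
    [opposite_gen] becomes that of the m-th product of X and Y(theta a). *)
Lemma has_adjoint_gen n a b m : has_adjoint n a ->
  has_adjoint (n + (d b)%:Z - m - 1) (X b m a).
Proof.
move=> [na Ha]; split; first exact: gen_wt.
move=> k u v; have [J0 JP] := opposite_gen b m k u na.
pose B := Y (theta a).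
have [J1 P1] := expansion_bound (X b) B k v.
have [J2 P2] := expansion_bound B (X b) 0 v.
pose J := (J0 + J1 + J2)%N.
rewrite (JP J) ?/J; last by lia.
rewrite -/J theta_X YZ (Y_nprod hlow hcyc hvac hY) nprodE /borcherds -/B.
rewrite (P1 J) ?(P2 J); try by rewrite /J; lia.
pose F1 j := f u (X b (m - j%:Z) (B (k + j%:Z) v)).
pose F2 j := f u (B (k + m - j%:Z) (X b j%:Z v)).
have E1 : f (\sum_(j < J) X b (2 * (d b)%:Z - 2 - j%:Z)
      (opposite n a (k + m - j%:Z) u) *~ sbin m j) v
   = \sum_(j < J) F2 j *~ sbin m j.
  rewrite (form_sum_mulz _ (fun j : nat =>
    X b (2 * (d b)%:Z - 2 - j%:Z) (opposite n a (k + m - j%:Z) u))).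
  by apply: eq_bigr => j _; rewrite gen_adjoint Ha.
have E2 : f (\sum_(j < J) opposite n a (k + j%:Z)
      (X b (2 * (d b)%:Z - 2 - m + j%:Z) u) *~ sbin m j) v
   = \sum_(j < J) F1 j *~ sbin m j.
  rewrite (form_sum_mulz _ (fun j : nat =>
    opposite n a (k + j%:Z) (X b (2 * (d b)%:Z - 2 - m + j%:Z) u))).
  apply: eq_bigr => j _; rewrite Ha.
  have -> : 2 * (d b)%:Z - 2 - m + j%:Z = 2 * (d b)%:Z - 2 - (m - j%:Z) by lia.
  by rewrite gen_adjoint.
have E3 : f u (\sum_(j < J) X b (m + 0 - j%:Z) (B (k + j%:Z) v) *~ sbin m j)
   = \sum_(j < J) F1 j *~ sbin m j.
  rewrite (form_sum_mulzr _ (fun j : nat => X b (m + 0 - j%:Z) (B (k + j%:Z) v))).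
  by apply: eq_bigr => j _; rewrite addr0.
have E4 : f u (\sum_(j < J) B (m + k - j%:Z) (X b (0 + j%:Z) v) *~ sbin m j)
   = \sum_(j < J) F2 j *~ sbin m j.
  rewrite (form_sum_mulzr _ (fun j : nat => B (m + k - j%:Z) (X b (0 + j%:Z) v))).
  by apply: eq_bigr => j _; rewrite add0r (addrC m).
rewrite linearZl_LR linearBl linearZl_LR /= E1 E2.
rewrite linearZr_LR linearBr linearZr_LR /= E3 E4 sign_weight.
have -> : Num.conj ((-1 : R[i]) ^+ d b) = (-1) ^+ d b by rewrite rmorphXn rmorphN1.
rewrite conj_sign mulNr -mulrN -mulrA opprB mulrBr mulrA sign_sq mul1r.
by [].
Qed.

Lemma has_adjoint_wt n a : wt L n a -> has_adjoint n a.
Proof.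
move=> /(wt_span hrep hlow hcyc hvac)[->|[p -> wa]].
  exact: (subspace0 (has_adjoint_subspace n)).
apply: lin_span_min wa => [|u [e wu]]; first exact: has_adjoint_subspace.
elim: wu => [|q e' p' v _ IH|q e' p' v _ IH]; first exact: has_adjoint_vac.
- have := has_adjoint_gen true (- q%:Z) IH => /=.
  have -> : - q%:Z - 1 = - q.+1%:Z by lia.
  have -> // : p'%:Z + 2 - (- q%:Z) - 1 = (q.+1 + p')%N :> int by lia.
- have := has_adjoint_gen false (1 - q%:Z) IH => /=.
  have -> : 1 - q%:Z - 2 = - q.+1%:Z by lia.
  have -> // : p'%:Z + 3 - (1 - q%:Z) - 1 = (q.+1 + p')%N :> int by lia.
Qed.

Lemma adjoint_modes a s g k u v :
  weight_decomposition (fun v n => Y v n) (L (-2) Om) a s g ->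
  f (adjoint_mode (fun v n => Y v n) (L (-2) Om) s g k u) v = f u (Y (theta a) k v).
Proof.
case=> _ wg ->; rewrite /adjoint_mode (vir_L hlow hcyc hvac hY).
rewrite -/(opposite _ _ _ _); elim: s wg => [|n s IH] wg.
  by rewrite !big_nil theta0 Y0 linear0l linear0r.
rewrite !big_cons thetaD -[theta (g n)]scale1r YP scale1r form_addl form_addr IH; last first.
  by move=> n' n's; apply: wg; rewrite inE n's orbT.
have /(weight_vectorE hlow hcyc hvac hY)/has_adjoint_wt[_ H] := wg n (mem_head _ _).
by rewrite -H.
Qed.

End Invariance.
End Theta.

(** The form is rescaled so that Om has norm 1. *)
Theorem W3_unitary_voa (f : {dot V for Num.conj}) : invariant_form L W f ->
  unitary_voa (fun v n => Y v n) Om (L (-2) Om).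
Proof.
move=> f_inv.
have k0 : 0 < (f Om Om)^-1 by rewrite invr_gt0 dnorm_gt0 (lwv_neq0 hlow).
have g_inv : invariant_form L W (scaled_dot f k0).
  case: f_inv => fL fW.
  by split=> n x y; rewrite /= /scaled_form ?fL ?fW.
have [theta [tP tK tOm tL tW]] := conjugation_exists hrep hlow hcyc hvac g_inv.
exists (scaled_dot f k0), theta; split.
- by rewrite /= /scaled_form mulVf // dnorm_eq0 (lwv_neq0 hlow).
- exact: theta_automorphism.
- by move=> a s g wd u v k; apply: adjoint_modes.
Qed.

(** If an ideal J contains y with (Om, y) nonzero, then the component of weight
    0 of y is a nonzero multiple of Om, and it lies in J because J is stable
    under L_0.  Otherwise Om, and hence V, is orthogonal to J. *)
Theorem W3_simple_voa (f : {dot V for Num.conj}) : invariant_form L W f ->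
  simple_voa (fun v n => Y v n).
Proof.
move=> [fL fW] J [Jsub JY].
have [J0 JP] := Jsub.
have JL n v : v \in J -> L n v \in J.
  by rewrite -(Y_L hlow hcyc hvac hY); apply: JY.
have JW n v : v \in J -> W n v \in J.
  by rewrite -(Y_W hlow hcyc hvac hY); apply: JY.
have [OmJ|OmJ] := boolP (Om \in J).
  by right=> v; rewrite (hcyc Jsub OmJ JL JW).
left.
have fOm y : y \in J -> f Om y = 0.
  move=> yJ; apply/eqP; apply: contraNT OmJ => fy.
  have [g [N [gP yE]]] := graded_sum hrep hlow hcyc hvac y.
  have gw (p : nat) : wt L p (g p).
    by apply: lin_span_min (gP p); [exact: wt_subspace|exact: (wt_word hrep hlow hvac)].
  have JZ k v : v \in J -> k *: v \in J by move=> vJ; rewrite -[_ *: _]addr0 JP.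
  (* An element of J has its component of weight 0 in J: the operator
     L_0 - (M + 1) removes the highest component and multiplies the lowest one
     by a nonzero scalar. *)
  have low M (g' : nat -> V) : (forall p : nat, wt L p (g' p)) ->
      \sum_(p < M.+1) g' p \in J -> g' 0%N \in J.
    elim: M g' => [|M IH] g' g'w g'J; first by rewrite big_ord1 in g'J.
    have := IH (fun p => (p%:Z - M.+1%:Z)%:~R *: g' p) _ _.
    move=> H; rewrite -[g' 0%N]scale1r -(@mulVf _ (0%:Z - M.+1%:Z)%:~R).
      rewrite -scalerA; apply/JZ/H => [p|]; first exact: (subspaceZ _ (wt_subspace L p)).
      have -> : \sum_(p < M.+1) (p%:Z - M.+1%:Z)%:~R *: g' p =
          - M.+1%:R *: \sum_(p < M.+2) g' p + L 0 (\sum_(p < M.+2) g' p).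
        rewrite scaler_sumr linear_sum -big_split [RHS]big_ord_recr /=.
        rewrite (g'w M.+1) scaleNr -pmulrn addNr addr0; apply: eq_bigr => p _.
        by rewrite g'w -scalerDl intrB addrC.
      by rewrite JP // JL.
    by rewrite intr_eq0; lia.
  have g0J : g 0%N \in J.
    case: N yE => [|N] yE; first by rewrite yE big_ord0 linear0r eqxx in fy.
    by apply: (low N) => //; rewrite -yE.
  have [a ga] : exists a, g 0%N = a *: Om.
    elim: (gP 0%N) => [|b u v [e wu] _ [a ->]]; first by exists 0; rewrite scale0r.
    exists (b + a); rewrite scalerDl; congr (_ *: _ + _).
    by move: wu; move p0E : 0%N => p0 wu; case: wu p0E.
  have fg (p : nat) : p != 0%N -> f Om (g p) = 0.
    move=> p0; have := fL 0 Om (g p).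
    rewrite oppr0 (L_vac hrep hlow hvac) // linear0l gw linearZr_LR /= => /esym/eqP.
    by rewrite mulf_eq0 rmorph_int intr_eq0 => /orP[/eqP|/eqP //]; lia.
  have a0 : a != 0.
    apply: contra_neq fy => a0; rewrite yE linear_sumr big1 // => p _.
    have [->|/fg //] := eqVneq (p : nat) 0%N.
    by rewrite ga a0 scale0r linear0r.
  by rewrite -[Om]scale1r -(mulVf a0) -scalerA -ga JZ.
have perp u : forall y, y \in J -> f u y = 0.
  move: u; apply: (cyclic_ind hcyc) => //.
  - split=> [y _|a u v Hu Hv y yJ]; first by rewrite linear0l.
    by rewrite form_linl Hu ?Hv // mulr0 addr0.
  - by move=> n u Hu y yJ; rewrite -[n]opprK fL Hu // JL.
  - by move=> n u Hu y yJ; rewrite -[n]opprK fW Hu // JW.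
move=> y; rewrite !inE; apply/idP/eqP => [yJ|->//].
exact: form_eq0 (perp y y yJ).
Qed.

End Unitary.

Unset Implicit Arguments.

Theorem mainTheorem7 (R : realType) (V : lmodType R[i]) (c h w : R[i])
    (L W : int -> {linear V -> V}) (Om : V)
    (hc : c != - (22%:R / 5%:R))
    (hrep : W3_representation c L W)
    (hlow : lowest_weight_vector L W h w Om)
    (hcyc : cyclic_vector L W Om)
    (hvac : L (- 1) Om = 0) :
  exists Y : V -> int -> V -> V,
    vertex_operator_algebra Y Om (L (- 1)) (L (- 2) Om) /\
    generated_by Y Om L W /\
    ((exists f : {dot V for Num.conj}, invariant_form L W f) ->
     simple_voa Y /\ unitary_voa Y Om (L (- 2) Om)).
Proof.
have [Y hY] := state_field_map_exists hrep hlow hcyc hvac.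
exists (fun v n => Y v n); split; first exact: (W3_voa hlow hcyc hvac hY).
split; first exact: (W3_generated hlow hcyc hvac hY).
case=> f f_inv; split; first exact: (W3_simple_voa hlow hcyc hvac hY f_inv).
exact: (W3_unitary_voa hlow hcyc hvac hY f_inv).
Qed.
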